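(* Let $\Gamma$ be a group, $G$ a connected $\Gamma$-graph, and $M$ a median $\Gamma$-graph. (1) Suppose $G$ admits a $\Gamma$-canonical median decomposition $(M,\beta)$ over $M$. (a) If $(M,\beta)$ is proper, then there exists a $\Gamma$-equivariant coarse embedding $f:G\to M'$, where $M'$ is the first cubical subdivision of $M$. (b) If $M$ is crossing-bounded and $(M,\beta)$ is geometric, then there exists a $\Gamma$-equivariant quasi-isometry $f:G\to M'$. (2) Suppose that either $G$ has bounded degree, or $M$ is crossing-bounded. Let $f:G\to M$ be a $\Gamma$-equivariant coarse embedding (respectively, quasi-isometry). Then the pull-back median decomposition over $f$ is $\Gamma$-canonical and proper (respectively, geometric).
   Context: Graphs are simple, undirected, possibly infinite; $d$ is the path metric. A $\Gamma$-graph is a graph with an action of $\Gamma$ by automorphisms. Median graphs. $I(u,v)$ is the set of vertices on some geodesic (shortest path) from $u$ to $v$. A median graph is a connected graph in which $I(u,v)\cap I(v,w)\cap I(w,u)$ is a single vertex for all $u,v,w$. A subgraph $C$ is convex if every geodesic with endpoints in $C$ is contained in $C$. On oriented edges of a median graph $M$ define $(x,y)\,\Theta\,(u,v)$ iff $d(x,u)+d(y,v)<d(x,v)+d(y,u)$; the classes of this equivalence relation are the oriented $\Theta$-classes, forming the set $\vec{\mathcal H}(M)$. For $\mathfrak h=[(u,v)]$ put $\mathfrak h_+=\{w: d(w,u)<d(w,v)\}$, $\mathfrak h_-=\{w: d(w,u)>d(w,v)\}$. Classes $\mathfrak h,\mathfrak h'$ cross if all four sets $\mathfrak h_\pm\cap\mathfrak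 h'_\pm$ are non-empty. $M$ is crossing-bounded if the cardinalities of sets of pairwise-crossing $\Theta$-classes are finite and uniformly bounded. An $n$-cube in $M$ ($n\ge0$) is an induced subgraph isomorphic to the $n$-dimensional cube graph. The first cubical subdivision $M'$ of $M$ is the graph whose vertices are the cubes of $M$, two cubes being adjacent iff one is contained in the other and their dimensions differ by exactly 1; it is a median graph, and an action of $\Gamma$ on $M$ extends naturally to $M'$. Median decompositions. A median decomposition of $G$ over $M$ is a pair $(M,\beta)$ with $\beta:V(M)\to\mathcal P(V(G))$ such that (M1) $\bigcup_u\beta(u)=V(G)$; (M2) every edge of $G$ has both ends in some $\beta(u)$; (M3) for every $v\in V(G)$ the fibre $\beta^{-1}(v)=\{u: v\in\beta(u)\}$ induces a convex subgraph of $M$. It is $\Gamma$-canonical if $g\cdot\beta(v)=\beta(g\cdot v)$ for all $v\in V(M)$, $g\in\Gamma$. It has bounded fibres if there is $R\ge0$ with $\operatorname{diam}(\beta^{-1}(x))\le R$ for all $x\in V(G)$. It is properly supported if for all $r\ge0$ there is $R\ge0$ such that for all $v\in V(M)$, $\operatorname{diam}\{x\in V(G): d(v,\beta^{-1}(x))\le r\}\le R$. It is quasi-densely supported if there is $R\ge0$ such that for all $v\in V(M)$ there is $u\in V(M)$ with $d(u,v)\le R$ and $\beta(u)\neq\emptyset$. It is proper if it has bounded fibres and is properly supported; geometric if it is proper and quasi-densely supported. Pull-back. For a map $\varphi:V(G)\to V(M)$ and $\mathfrak h\in\vec{\mathcal H}(M)$ let $A_{\mathfrak h}=N[\varphi^{-1}(\mathfrak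 h_+)]$, where $N[X]$ is the closed neighbourhood of $X$ in $G$ ($X$ together with all neighbours of its vertices). The pull-back median decomposition over $\varphi$ is $(M,\beta)$ with $\beta(v)=\bigcap_{\mathfrak h: v\in\mathfrak h_+}A_{\mathfrak h}$ (the empty intersection being $V(G)$); it is a median decomposition. Coarse maps. A map $f:V(X)\to V(Y)$ between graphs (not necessarily a graph morphism) is a coarse embedding if there are $K_1\ge1$ and a non-decreasing $\rho:\mathbb N\to\mathbb N$ with $\rho(n)\to\infty$ such that $K_1d(x,y)+K_1\ge d(f(x),f(y))\ge\rho(d(x,y))$ for all $x,y$. It is a quasi-isometry if moreover the lower bound can be taken of the form $\rho(n)=\frac1{K_2}n-K_2$ for some $K_2\ge1$ and there is $K_3\ge0$ such that every $y\in V(Y)$ is within distance $K_3$ of some $f(x)$. It is $\Gamma$-equivariant if $g\cdot f(x)=f(g\cdot x)$ for all $g\in\Gamma$ and $x$. *)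

(* Defs.v *)
From HB Require Import structures.
From Stdlib Require List.
From mathcomp Require Import all_boot all_order all_algebra.
From mathcomp Require Import boolp classical_sets functions cardinality reals.

Set Implicit Arguments.
Unset Strict Implicit.
Unset Printing Implicit Defensive.

Import Order.TTheory GRing.Theory Num.Theory.

Local Open Scope classical_set_scope.
Local Open Scope card_scope.

Record graph := Graph {
  vertex :> Type;
  adj : rel vertex;
  adj_sym : symmetric adj;
  adj_irr : irreflexive adj }.

Arguments adj {g}.

Section Distance.
Variable G : graph.
Implicit Types (u v w x y : G) (p : seq G) (S : set G).

(* The walk [p] from [x] to [y] lists its vertices other than the first one,
   so that [size p] is its length. *)
Definition walk x y p : Prop := path adj x p /\ last x p = y.

Definition walk_of_length x y n : Prop := exists2 p, walk x y p & size p = n.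

Definition connected_graph : Prop := forall x y, exists p, walk x y p.

(* Junk value 0 between distinct connected components; it plays no role in
   connected graphs. *)
Definition dist x y : nat :=
  if pselect (exists n, `[< walk_of_length x y n >]) is left ex
  then ex_minn ex else 0.

Definition geodesic x y p : Prop := walk x y p /\ size p = dist x y.

Definition geodesic_interval u v : set G :=
  [set w | exists2 p, geodesic u v p & List.In w (u :: p)].

Definition geodesically_convex S : Prop :=
  forall u v, S u -> S v -> geodesic_interval u v `<=` S.

Definition median_graph : Prop :=
  connected_graph /\
  forall u v w, exists! x,
    (geodesic_interval u v `&` geodesic_interval v w
       `&` geodesic_interval w u) x.

Definition diam_le S (R : nat) : Prop :=
  forall x y, S x -> S y -> dist x y <= R.

Definition closed_nbhd S : set G :=
  [set y | S y \/ exists2 x, S x & adj x y].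

Definition bounded_degree : Prop :=
  exists D : nat, forall x, [set y | adj x y] #<= `I_D.

End Distance.

Section ThetaClasses.
Variable M : graph.
Implicit Types (e : M * M) (h : set (M * M)).

Definition oriented_edge e : Prop := adj e.1 e.2.

Definition theta e e' : Prop :=
  dist e.1 e'.1 + dist e.2 e'.2 < dist e.1 e'.2 + dist e.2 e'.1.

Definition theta_class h : Prop :=
  exists2 e, oriented_edge e & h = [set e' | oriented_edge e' /\ theta e' e].

(* In a median graph these do not depend on the edge chosen in the class [h],
   so that quantifying over all representatives is harmless. *)
Definition hplus h : set M :=
  [set w | exists2 e, h e & dist w e.1 < dist w e.2].
Definition hminus h : set M :=
  [set w | exists2 e, h e & dist w e.2 < dist w e.1].

Definition crossing h h' : Prop :=
  [/\ hplus h `&` hplus h' !=set0, hplus h `&` hminus h' !=set0,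
      hminus h `&` hplus h' !=set0 & hminus h `&` hminus h' !=set0].

(* A class and its opposite never cross, so that passing to unoriented classes
   would not change the cardinalities of pairwise crossing sets. *)
Definition crossing_bounded : Prop :=
  exists N : nat, forall H : set (set (M * M)),
    H `<=` theta_class ->
    (forall h h', H h -> H h' -> h <> h' -> crossing h h') ->
    H #<= `I_N.

End ThetaClasses.

Section Cubes.
Variable M : graph.
Implicit Types P Q : set M.

Definition cube_adj n (a b : {ffun 'I_n -> bool}) : bool :=
  #|[pred i | a i != b i]| == 1.

Definition is_cube n Q : Prop :=
  exists phi : {ffun 'I_n -> bool} -> M,
    [/\ injective phi, forall a b, adj (phi a) (phi b) = cube_adj a b
      & range phi = Q].

Definition cube : Type := {Q : set M | exists n, is_cube n Q}.

Definition face_rel P Q : Prop :=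
  exists m n, [/\ is_cube m P, is_cube n Q, P `<=` Q \/ Q `<=` P
                & n = m.+1 \/ m = n.+1].

Definition subdivision_adj (P Q : cube) : bool :=
  `[< face_rel (sval P) (sval Q) >].

Lemma is_cube_dim_le m n Q : is_cube m Q -> is_cube n Q -> m <= n.
Proof.
move=> [phi [phi_inj _ phiQ]] [psi [_ _ psiQ]].
have lift_phi a : exists b, psi b = phi a.
  have : Q (phi a) by rewrite -phiQ; exists a.
  by rewrite -psiQ => -[b _ <-]; exists b.
have [f fP] := choice lift_phi.
have f_inj : injective f.
  by move=> a b fab; apply: phi_inj; rewrite -!fP fab.
have := leq_card f f_inj.
by rewrite !card_ffun card_bool !card_ord leq_exp2l.
Qed.

Lemma is_cube_dim m n Q : is_cube m Q -> is_cube n Q -> m = n.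
Proof.
by move=> mQ nQ; apply/eqP; rewrite eqn_leq !(@is_cube_dim_le _ _ Q).
Qed.

Lemma cube_eq (A B : cube) : sval A = sval B -> A = B.
Proof.
case: A B => [A cA] [B cB] /= AB; subst B.
by rewrite (Prop_irrelevance cA cB).
Qed.

Lemma subdivision_adj_sym : symmetric subdivision_adj.
Proof.
suff sub (A B : cube) : subdivision_adj A B -> subdivision_adj B A.
  by move=> A B; apply/idP/idP; apply: sub.
move=> /asboolP[m [n [mP nQ PQ mn]]]; apply/asboolP; exists n, m.
by split=> //; [case: PQ; [right|left] | case: mn; [right|left]].
Qed.

Lemma subdivision_adj_irr : irreflexive subdivision_adj.
Proof.
move=> A; apply/negP => /asboolP[m [n [mP nP _]]].
rewrite (is_cube_dim mP nP) => -[] /eqP.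
  by rewrite -[X in X == _]addn0 -addn1 eqn_add2l.
by rewrite -[X in X == _]addn0 -addn1 eqn_add2l.
Qed.

Definition subdivision : graph :=
  Graph subdivision_adj_sym subdivision_adj_irr.

End Cubes.

Section Actions.
Variable Gamma : groupType.
Local Open Scope group_scope.

Record ggraph := GGraph {
  ggraph_graph :> graph;
  act : Gamma -> ggraph_graph -> ggraph_graph;
  act1 : forall x, act 1 x = x;
  actM : forall g h x, act (g * h) x = act g (act h x);
  act_adj : forall g x y, adj (act g x) (act g y) = adj x y }.

Definition equivariant (X Y : ggraph) (f : X -> Y) : Prop :=
  forall g x, act g (f x) = f (act g x).

Section SubdivisionAction.
Variable M : ggraph.

Lemma act_inj g : injective (@act M g).
Proof. by move=> x y /(congr1 (act g^-1)); rewrite -!actM mulVg !act1. Qed.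

Lemma is_cube_act g n (Q : set M) : is_cube n Q -> is_cube n (act g @` Q).
Proof.
move=> [phi [phi_inj phi_adj <-]]; exists (act g \o phi); split.
- by move=> a b /act_inj/phi_inj.
- by move=> a b; rewrite /= act_adj.
- by rewrite image_comp.
Qed.

Definition cube_act g (Q : cube M) : cube M :=
  exist _ (act g @` sval Q)
    (let: ex_intro n nQ := svalP Q in ex_intro _ n (is_cube_act g nQ)).

Lemma cube_act1 Q : cube_act 1 Q = Q.
Proof.
apply: cube_eq; rewrite /=; apply/seteqP; split=> x.
  by move=> [y Qy <-]; rewrite act1.
by move=> Qx; exists x; rewrite ?act1.
Qed.

Lemma cube_actM g h Q : cube_act (g * h) Q = cube_act g (cube_act h Q).
Proof.
apply: cube_eq; rewrite /= image_comp; congr image.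
by apply/funext => x /=; rewrite actM.
Qed.

Lemma cube_act_adj g P Q :
  subdivision_adj (cube_act g P) (cube_act g Q) = subdivision_adj P Q.
Proof.
have sub k A B : subdivision_adj A B ->
    subdivision_adj (cube_act k A) (cube_act k B).
  move=> /asboolP[m [n [mA nB AB mn]]]; apply/asboolP; exists m, n; split=> //.
  - exact: is_cube_act.
  - exact: is_cube_act.
  - by case: AB => /image_subset AB; [left|right]; apply: AB.
apply/idP/idP; last exact: sub.
by move/(sub g^-1); rewrite -!cube_actM mulVg !cube_act1.
Qed.

Definition gsubdivision : ggraph :=
  @GGraph (subdivision M) cube_act cube_act1 cube_actM cube_act_adj.

End SubdivisionAction.
End Actions.

Section Decompositions.
Variables G M : graph.
Variable beta : M -> set G.

Definition fibre (x : G) : set M := [set u | beta u x].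

Definition median_decomposition : Prop :=
  [/\ \bigcup_(u in [set: M]) beta u = [set: G],
      forall x y : G, adj x y -> exists u, beta u x /\ beta u y
    & forall x : G, geodesically_convex (fibre x)].

Definition bounded_fibres : Prop :=
  exists R : nat, forall x, diam_le (fibre x) R.

Definition properly_supported : Prop :=
  forall r : nat, exists R : nat, forall v : M,
    diam_le [set x | exists2 u, fibre x u & dist v u <= r] R.

Definition quasi_densely_supported : Prop :=
  exists R : nat, forall v : M,
    exists u : M, dist u v <= R /\ beta u !=set0.

Definition proper_decomposition : Prop := bounded_fibres /\ properly_supported.

Definition geometric_decomposition : Prop :=
  proper_decomposition /\ quasi_densely_supported.

End Decompositions.

Definition canonical_decomposition (Gamma : groupType) (G M : ggraph Gamma)
    (beta : M -> set G) : Prop :=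
  forall (g : Gamma) (v : M), act g @` beta v = beta (act g v).

Definition pullback (G M : graph) (phi : G -> M) (v : M) : set G :=
  \bigcap_(h in [set h | theta_class h /\ hplus h v])
    closed_nbhd (phi @^-1` hplus h).

Section CoarseMaps.
Variables (R : realType) (X Y : graph) (f : X -> Y).
Local Open Scope ring_scope.

Definition coarse_embedding : Prop :=
  exists (K1 : R) (rho : nat -> nat),
    [/\ 1 <= K1,
        {homo rho : m n / (m <= n)%N},
        forall N : nat, exists n0 : nat, forall n, (n0 <= n)%N -> (N <= rho n)%N
      & forall x y, (dist (f x) (f y))%:R <= K1 * (dist x y)%:R + K1 /\
                    (rho (dist x y) <= dist (f x) (f y))%N].

Definition quasi_isometry : Prop :=
  [/\ coarse_embedding,
      exists2 K2 : R, 1 <= K2 &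
        forall x y, (dist x y)%:R / K2 - K2 <= (dist (f x) (f y))%:R
    & exists2 K3 : R, 0 <= K3 &
        forall y, exists x, (dist y (f x))%:R <= K3].

End CoarseMaps.

(* Main.v *)
Require Import Defs.
From mathcomp Require Import all_boot all_order all_algebra zify.
From mathcomp Require Import boolp classical_sets functions cardinality reals.

(* Distances in a median graph count separating halfspaces, and convex sets have
   the Helly property, even for infinite families provided one member is bounded.

   Part 1. For a bounded convex set C let the depth of a halfspace H be the
   largest distance from a point of C in H to the complement of H; it strictly
   increases with H. Intersect C with every halfspace that is deeper than its
   complement. The result is nonempty by Helly, and the halfspaces that still
   cut it are exactly as deep as their complements, hence cross pairwise, so it
   is a cube. This centre is canonical, and f sends x to the centre of the fibre
   over x.

   Part 2. The fibre of the pull-back over x is the convex hull of f(N[x]). A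
   halfspace separating two of its points separates two points of f(N[x]): if
   N[x] is finite, count pairs (neighbour, step of a geodesic); if M is
   crossing-bounded, halfspaces of equal depth with respect to f(N[x]) cross, and
   there are boundedly many depths. *)

Set Implicit Arguments.
Unset Strict Implicit.
Unset Printing Implicit Defensive.

Local Open Scope classical_set_scope.
Local Open Scope card_scope.

(** * Path metric and geodesics of a connected graph *)

Section DistanceTheory.
Variable G : graph.
Implicit Types (u v w x y z : G) (p q : seq G).

Lemma dist_le_walk x y p : walk x y p -> dist x y <= size p.
Proof.
move=> xyp; rewrite /dist; case: pselect => // ex.
by case: ex_minnP => m _; apply; apply/asboolP; exists p.
Qed.

Lemma walk_cat x y z p q : walk x y p -> walk y z q -> walk x z (p ++ q).
Proof. by move=> [xp <-] [pq <-]; split; rewrite ?cat_path ?xp // last_cat. Qed.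

Lemma distxx x : dist x x = 0.
Proof. by apply/eqP; rewrite -leqn0; apply: (@dist_le_walk _ _ [::]). Qed.

Lemma walk_rev x y p : walk x y p -> exists2 q, walk y x q & size q = size p.
Proof.
move=> [xp <-]; exists (rev (belast x p)); last by rewrite size_rev size_belast.
split; last by case: p {xp} => //= a p; rewrite rev_cons last_rcons.
by rewrite rev_path; apply: sub_path xp => a b; rewrite /= adj_sym.
Qed.

Hypothesis connG : connected_graph G.

Lemma geodesic_exists x y : exists p, geodesic x y p.
Proof.
have [p xyp] := connG x y.
rewrite /geodesic /dist; case: pselect => [ex|[]]; last first.
  by exists (size p); apply/asboolP; exists p.
case: ex_minnP => m /asboolP[q xyq qm] _; by exists q.
Qed.

Lemma dist_sym x y : dist x y = dist y x.
Proof.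
suff le (a b : G) : dist a b <= dist b a by apply/eqP; rewrite eqn_leq !le.
have [p [/walk_rev[q abq <-] <-]] := geodesic_exists b a.
exact: dist_le_walk.
Qed.

Lemma dist_triangle y x z : dist x z <= dist x y + dist y z.
Proof.
have [p [xyp <-]] := geodesic_exists x y.
have [q [yzq <-]] := geodesic_exists y z.
by rewrite -size_cat; apply: dist_le_walk; apply: walk_cat yzq.
Qed.

Lemma dist0_eq x y : dist x y = 0 -> x = y.
Proof. by have [[|a p] [[_ <-] <-]] := geodesic_exists x y. Qed.

Lemma dist_gt0 x y : x <> y -> 0 < dist x y.
Proof. by move=> xy; rewrite lt0n; apply/eqP => /dist0_eq. Qed.

Lemma adj_neq x y : adj x y -> x <> y.
Proof. by move=> xy e; move: xy; rewrite e adj_irr. Qed.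

Lemma dist_adj x y : adj x y -> dist x y = 1.
Proof.
move=> xy; apply/eqP; rewrite eqn_leq dist_gt0 ?andbT; last exact: adj_neq.
by apply: (@dist_le_walk _ _ [:: y]); split; rewrite //= xy.
Qed.

Lemma dist_step x y n : dist x y = n.+1 -> exists2 z, adj x z & dist z y = n.
Proof.
move=> xyn; have [[|z p] [[]]] := geodesic_exists x y; rewrite xyn //=.
move=> /andP[xz zp] lp [pn]; exists z => //; apply/eqP.
rewrite eqn_leq -{1}pn (@dist_le_walk z y p) //=.
by have := dist_triangle z x y; rewrite xyn dist_adj.
Qed.

Lemma dist1_adj x y : dist x y = 1 -> adj x y.
Proof. by move=> /dist_step[z xz /dist0_eq <-]. Qed.

Lemma intervalP u v w :
  geodesic_interval u v w <-> dist u w + dist w v = dist u v.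
Proof.
split=> [[p [[up pv] pd] wp]|uwv]; last first.
  have [p [uwp up]] := geodesic_exists u w.
  have [q [wvq wq]] := geodesic_exists w v.
  exists (p ++ q); first by split; [apply: walk_cat wvq|rewrite size_cat; lia].
  case: uwp => _ <-; elim: p u {uwv up} => /= [|a s IH] u; first by left.
  by right; apply: IH.
suff [p1 [p2 [pE pw]]] : exists p1 p2, p = p1 ++ p2 /\ last u p1 = w.
  subst p; move: up pv pd; rewrite cat_path last_cat size_cat pw.
  move=> /andP[up1 wp2] pv pd.
  have := dist_triangle w u v.
  have := @dist_le_walk u w p1 (conj up1 pw).
  by have := @dist_le_walk w v p2 (conj wp2 pv); lia.
elim: p u wp {up pv pd} => /= [|a p IH] u [<-|//].
- by exists [::], [::].
- by exists [::], (a :: p).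
move=> /IH[p1 [p2 [-> pw]]]; by exists (a :: p1), p2.
Qed.

Lemma geodesic_param u v : exists c : nat -> G,
  [/\ c 0 = u, c (dist u v) = v & forall i, i < dist u v -> adj (c i) (c i.+1)].
Proof.
have [n] : exists n, dist u v = n by exists (dist u v).
elim: n u => [|n IH] u uvn.
  by exists (fun=> u); rewrite uvn; split=> //; apply: dist0_eq.
have [z uz zvn] := dist_step uvn.
have [c [c0 cn cadj]] := IH z zvn; rewrite uvn.
exists (fun i => if i is j.+1 then c j else u); split=> //; first by rewrite -zvn.
by case=> [_|i ilt]; [rewrite c0 | apply: cadj; rewrite zvn].
Qed.

End DistanceTheory.

(** * Halfspaces of a median graph *)

Definition convex_halfspace (M : graph) (u v : M) : set M :=
  [set w | dist w u < dist w v].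
Local Notation W := convex_halfspace.

Definition halfspace (M : graph) (H : set M) : Prop :=
  exists u v : M, adj u v /\ H = W u v.

Lemma median_connected (M : graph) : median_graph M -> connected_graph M.
Proof. by case. Qed.

Section MedianTheory.
Variable M : graph.
Hypothesis medM : median_graph M.
Local Notation connM := (median_connected medM).
Implicit Types (u v w x y z m : M) (H K C : set M).

Lemma median_exists u v w : exists m,
  [/\ dist u m + dist m v = dist u v, dist v m + dist m w = dist v w
    & dist w m + dist m u = dist w u].
Proof.
have [m [[[uv vw] wu] _]] := medM.2 u v w.
by exists m; split; apply/(intervalP connM).
Qed.

Lemma median_unique u v w m m' :
  dist u m + dist m v = dist u v -> dist v m + dist m w = dist v w ->
  dist w m + dist m u = dist w u ->
  dist u m' + dist m' v = dist u v -> dist v m' + dist m' w = dist v w ->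
  dist w m' + dist m' u = dist w u -> m = m'.
Proof.
move=> *; have [n [_ nP]] := medM.2 u v w.
transitivity n; [symmetry|]; apply: nP; do 2 ?split; exact/(intervalP connM).
Qed.

(** Median graphs are bipartite: if [w] were equidistant from [u] and [v], so would be the median of
    the three, whose distances to [u] and [v] add up to 1. *)
Lemma dist_edge w u v :
  adj u v -> dist w v = (dist w u).+1 \/ dist w u = (dist w v).+1.
Proof.
move=> uv; have uv1 := dist_adj connM uv.
have [m [muv mvw mwu]] := median_exists u v w.
have := dist_triangle connM u w v; have := dist_triangle connM v w u.
rewrite (dist_sym connM v u) uv1 => t1 t2.
suff : dist w u <> dist w v by lia.
move=> e; rewrite (dist_sym connM m u) (dist_sym connM v m) in mvw mwu.
rewrite (dist_sym connM v w) (dist_sym connM m w) in mvw; lia.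
Qed.

Lemma convex_halfspaceC u v : adj u v -> ~` W u v = W v u.
Proof.
move=> uv; apply/seteqP; split=> w; rewrite /W /=; have := dist_edge w uv; lia.
Qed.

Lemma halfspaceC H : halfspace H -> halfspace (~` H).
Proof.
move=> [u [v [uv ->]]]; exists v, u; rewrite convex_halfspaceC //.
by rewrite adj_sym.
Qed.

(** If [w] were in only one of the two halfspaces, the distances around the 4-cycle would make two
    opposite vertices both medians of [w] and the other two. *)
Lemma square_halfspace x x' m y : adj x x' -> adj x' m -> adj m y -> adj y x ->
  x <> m -> x' <> y -> W x y = W x' m.
Proof.
move=> xx' x'm my yx xm x'y.
suff sub (a a' b c : M) : adj a a' -> adj a' b -> adj b c -> adj c a ->
    a <> b -> a' <> c -> W a c `<=` W a' b.
  by apply/seteqP; split; apply: sub; rewrite // adj_sym.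
move=> aa' a'b bc ca ab a'c w; rewrite /W /= => wac.
have := dist_edge w aa'; have := dist_edge w a'b; have := dist_edge w bc.
have := dist_edge w ca => e1 e2 e3 e4; apply: contrapT => wa'b.
have a'c2 : dist a' c = 2.
  have := dist_gt0 connM a'c; have := dist_triangle connM a a' c.
  have : dist a' c <> 1 by (move=> /(dist1_adj connM) /(dist_edge w); lia).
  rewrite (dist_sym connM a' a) (dist_sym connM a c).
  by rewrite (dist_adj connM aa') (dist_adj connM ca); lia.
have := (dist_adj connM aa', dist_adj connM a'b, dist_adj connM bc,
  dist_adj connM ca) => -[[[d1 d2] d3] d4].
have := (dist_sym connM a' a, dist_sym connM c a, dist_sym connM b a',
  dist_sym connM b c) => -[[[s1 s2] s3] s4].
have := (dist_sym connM w a, dist_sym connM w a', dist_sym connM w b,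
  dist_sym connM w c) => -[[[s5 s6] s7] s8].
by apply: ab; apply: (@median_unique a' c w); lia.
Qed.

(** Induction on the distance from [x] to [u]: a step [x'] towards [u] moves the edge across a
    square to one nearer to [u], and [square_halfspace] keeps the halfspace. *)
Lemma edge_crossing_halfspace u v x y :
  adj u v -> adj x y -> W u v x -> ~ W u v y -> W x y = W u v.
Proof.
move=> uv; have [k] : exists k, dist x u = k by exists (dist x u).
elim: k x y => [|k IH] x y xu xy.
  rewrite /W /= (dist0_eq connM xu) in xy *; rewrite distxx.
  move=> _ yuv; congr W; apply: (dist0_eq connM).
  have := dist_edge y uv; move: yuv.
  rewrite (dist_sym connM y u) (dist_adj connM xy); lia.
move=> xuv yuv; have {xuv} : dist x u < dist x v := xuv => xuv.
have {yuv} : ~ (dist y u < dist y v) := yuv => yuv.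
have [x' xx' x'u] := dist_step connM xu.
have := dist_edge x' uv; have := dist_edge x uv; have := dist_edge y uv.
have := dist_edge u xx'; have := dist_edge v xx'.
have := dist_edge u xy; have := dist_edge v xy.
rewrite !(dist_sym connM u) !(dist_sym connM v) => e1 e2 e3 e4 e5 e6 e7.
have x'y : x' <> y by move=> e; subst; lia.
have x'y2 : dist x' y = 2.
  have := dist_gt0 connM x'y.
  have := dist_triangle connM x x' y; rewrite (dist_sym connM x' x).
  rewrite (dist_adj connM xx') (dist_adj connM xy).
  have : dist x' y <> 1.
    by move=> /(dist1_adj connM) /(dist_edge v); rewrite !(dist_sym connM v); lia.
  lia.
(* The median of [x'], [y] and [v] is the fourth vertex of the square on [x'], [x], [y]. *)
have [m [m1 m2 m3]] := median_exists x' y v.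
rewrite (dist_sym connM v m) (dist_sym connM m x') (dist_sym connM v) in m3.
rewrite (dist_sym connM y m) in m2.
have x'm : adj x' m by apply: (dist1_adj connM); lia.
have my : adj m y by apply: (dist1_adj connM); lia.
have := dist_edge m uv; have := dist_edge u my.
rewrite !(dist_sym connM u) => e8 e9.
have <- : W x' m = W u v.
  by apply: IH => //; rewrite /W /=; lia.
apply: square_halfspace => //; first by rewrite adj_sym.
by move=> e; subst; lia.
Qed.

(** Betweenness is an equation between distances, so convexity goals become arithmetic. *)
Definition convex C := forall u v w, C u -> C v ->
  dist u w + dist w v = dist u v -> C w.

Lemma convexP C : convex C <-> geodesically_convex C.
Proof.
split=> [cC u v Cu Cv w /(intervalP connM)|cC u v w Cu Cv /(intervalP connM)].
  exact: cC.
exact: (cC u v).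
Qed.

Lemma halfspace_crossing H x y : halfspace H -> adj x y -> H x -> ~ H y ->
  H = W x y.
Proof. by move=> [u [v [uv ->]]] *; rewrite (edge_crossing_halfspace uv). Qed.

(** Follow a geodesic until it first leaves [C]; the equation records that the edge lies on a
    geodesic from [x] to [y]. *)
Lemma exists_crossing_edge C x y : C x -> ~ C y -> exists p q,
  [/\ adj p q, C p, ~ C q & dist x p + 1 + dist q y = dist x y].
Proof.
have [k] : exists k, dist x y = k by exists (dist x y).
elim: k x => [|k IH] x xy Cx Cy; first by case: Cy; rewrite -(dist0_eq connM xy).
have [z xz zy] := dist_step connM xy.
have [Cz|nCz] := pselect (C z); last by exists x, z; split=> //; rewrite distxx; lia.
have [p [q [pq Cp nCq e]]] := IH z zy Cz Cy; exists p, q; split=> //.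
have := dist_triangle connM z x p; rewrite (dist_adj connM xz).
have := dist_triangle connM p x y; have := dist_triangle connM q p y.
rewrite (dist_adj connM pq); lia.
Qed.

(** A geodesic from [a] to [z] would leave [H] along an edge [p q], so that [H] is the set of points
    nearer to [p] than to [q]. As [b] is one of them, going through [p] would be shorter than going
    through [z]. *)
Lemma halfspace_convex H : halfspace H -> convex H.
Proof.
move=> hH a b z Ha Hb azb; apply: contrapT => Hz.
have [p [q [pq Hp Hq e]]] := exists_crossing_edge Ha Hz.
have HW := halfspace_crossing hH pq Hp Hq.
move: Hb; rewrite HW /W /= => bpq.
have := dist_triangle connM p a b; have := dist_triangle connM z q b.
rewrite (dist_sym connM p b) (dist_sym connM q b); lia.
Qed.

Lemma halfspace_separation u v : u <> v ->
  exists H, [/\ halfspace H, H u & ~ H v].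
Proof.
move=> uv; have := dist_gt0 connM uv; case e: (dist u v) => [//|n] _.
have [z uz zv] := dist_step connM e; exists (W u z); split.
- by exists u, z.
- by rewrite /W /= distxx (dist_adj connM uz).
- by rewrite /W /= !(dist_sym connM v) e zv; lia.
Qed.

Lemma convexI C K : convex C -> convex K -> convex (C `&` K).
Proof.
by move=> cC cK u v w [Cu Ku] [Cv Kv] uwv; split; [apply: cC uwv|apply: cK uwv].
Qed.

End MedianTheory.

(** * Helly property of convex sets *)

Lemma max_exists (P : nat -> Prop) (D : nat) :
  P 0 -> (forall k, P k -> k <= D) ->
  exists2 k, P k & forall j, P j -> j <= k.
Proof.
move=> P0 PD; have ex : exists k, `[< P k >] by exists 0; apply/asboolP.
have ub k : `[< P k >] -> k <= D by move/asboolP/PD.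
by case: (ex_maxnP ex ub) => k /asboolP Pk kmax; exists k => // j /asboolP/kmax.
Qed.

Section Helly.
Variable M : graph.
Hypothesis medM : median_graph M.
Local Notation connM := (median_connected medM).
Implicit Types (A B C : set M) (F : set (set M)).

(** The median of [c], [p], [q] is in [C] and lies on geodesics from [c] to [p] and to [q]; being no
    nearer to [c] than they are, it equals both. *)
Lemma convex_nearest_unique C c k p q : convex C ->
  (forall x, C x -> k <= dist c x) -> C p -> C q ->
  dist c p = k -> dist c q = k -> p = q.
Proof.
move=> cC near Cp Cq cp cq.
have [m [m1 m2 m3]] := median_exists medM c p q.
have Cm : C m := cC p q m Cp Cq m2.
have := near m Cm; have s := dist_sym connM.
rewrite (s q m) (s m c) (s q c) in m3 => km.
have mp : dist m p = 0 by lia.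
have mq : dist m q = 0 by lia.
by rewrite -(dist0_eq connM mp) -(dist0_eq connM mq).
Qed.

(** Choose a point in each pairwise intersection. Each set contains two of the three points, hence
    their median. *)
Lemma helly_triple A B C : convex A -> convex B -> convex C ->
  A `&` B !=set0 -> B `&` C !=set0 -> C `&` A !=set0 ->
  exists x, [/\ A x, B x & C x].
Proof.
move=> cA cB cC [x [Ax Bx]] [y [By Cy]] [z [Cz Az]].
have [m [m1 m2 m3]] := median_exists medM x y z; exists m; split.
- exact: (cA z x).
- exact: (cB x y).
- exact: (cC y z).
Qed.

Lemma helly_finite n (K : nat -> set M) : (forall i, convex (K i)) ->
  (forall i j, K i `&` K j !=set0) -> exists x, forall i, i <= n -> K i x.
Proof.
elim: n K => [|n IH] K cK KK.
  by have [x [Kx _]] := KK 0 0; exists x => i; rewrite leqn0 => /eqP->.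
(* Intersect every member with [K n.+1]; [helly_triple] shows that the new family still meets
   pairwise. *)
have [|i j|x xK] := IH (fun i => K i `&` K n.+1).
- by move=> i; apply: convexI.
- have [x [Kix Kjx Kx]] := helly_triple (cK i) (cK j) (cK n.+1)
    (KK _ _) (KK _ _) (KK _ _).
  by exists x.
exists x => i; rewrite leq_eqVlt ltnS => /predU1P[->|/xK[]//].
by have [] := xK 0.
Qed.

(* Among the finite subfamilies take one whose intersection is farthest from
   a point [c] of the bounded member; shrinking it further does not move the
   nearest point to [c], which therefore lies in every member. *)
Lemma helly_bounded F C D : (forall A, F A -> convex A) ->
  (forall A B, F A -> F B -> A `&` B !=set0) -> F C -> diam_le C D ->
  exists x, forall A, F A -> A x.
Proof.
move=> cF FF FC CD; have [c [Cc _]] := FF C C FC FC.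
pose P k := exists K n, [/\ forall i, F (K i), K 0 = C
  & forall x, (forall i, i <= n -> K i x) -> k <= dist c x].
have [|k [K [n [KF K0 Kk]]]|k [K [n [KF K0 Kk]]] kmax] := @max_exists P D.
- by exists (fun=> C), 0.
- have [x xK] : exists x, forall i, i <= n -> K i x.
    by apply: helly_finite => [i|i j]; [apply: cF|apply: FF].
  by apply: leq_trans (Kk x xK) _; apply: CD => //; rewrite -K0; apply: xK.
have near A : F A -> exists x, [/\ forall i, i <= n -> K i x, A x & dist c x = k].
  move=> FA; apply: contrapT => noA.
  suff /kmax : P k.+1 by rewrite ltnn.
  exists (fun i => if i <= n then K i else A), n.+1; split=> [i||x xKA].
  - by case: ifP.
  - by [].
  have xK i : i <= n -> K i x by move=> ile; have := xKA i; rewrite ile; apply; lia.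
  rewrite ltn_neqAle Kk // andbT; apply/eqP => kx; apply: noA; exists x.
  by split=> //; have := xKA n.+1; rewrite ltnn; apply.
have [x [xK _ cx]] := near C FC; exists x => A FA.
have [y [yK Ay cy]] := near A FA.
suff -> : x = y by [].
apply: (@convex_nearest_unique [set z | forall i, i <= n -> K i z] c k) => //.
by move=> u v w Ku Kv uwv i ile; apply: (cF _ (KF i) u v) => //; [apply: Ku|apply: Kv].
Qed.

End Helly.

(** * Centre of a bounded convex set *)

Section Center.
Variable M : graph.
Hypothesis medM : median_graph M.
Local Notation connM := (median_connected medM).
Implicit Types (C H : set M) (k D : nat).

(** Depth is used through its lower bounds, so that defining the centre requires no maximum. *)
Definition depth_ge C H k : Prop :=
  exists2 s, C s & forall t, ~ H t -> k <= dist s t.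

Definition deeper_side C H : Prop :=
  exists2 k, depth_ge C H k & ~ depth_ge C (~` H) k.

Definition center C : set M :=
  [set z | C z /\ forall H, halfspace H -> deeper_side C H -> H z].

Lemma depth_ge_subset C H H' k :
  H `<=` H' -> depth_ge C H k -> depth_ge C H' k.
Proof. by move=> HH' [s Cs sH]; exists s => // t Ht; apply: sH => /HH'. Qed.

Lemma depth_ge_leq C H k k' : k' <= k -> depth_ge C H k -> depth_ge C H k'.
Proof.
by move=> kk' [s Cs sH]; exists s => // t Ht; apply: leq_trans kk' (sH t Ht).
Qed.

Lemma depth_ge_point C H s k :
  0 < k -> (forall t, ~ H t -> k <= dist s t) -> H s.
Proof. by move=> k0 sH; apply: contrapT => /sH; rewrite distxx leqNgt k0. Qed.

(** A geodesic from [s] to a point outside [H'] leaves [H'] along some edge [p q]. Were [p] in [H],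
    this edge would leave [H] as well and force [H = H']. So [p] is already at distance at least [k]
    from [s], and one more step follows. *)
Lemma depth_ge_proper C H H' k : halfspace H -> halfspace H' ->
  H `<=` H' -> H <> H' -> 0 < k -> depth_ge C H k -> depth_ge C H' k.+1.
Proof.
move=> hH hH' HH' neq k0 [s Cs sH]; exists s => // t H't.
have H's : H' s := HH' _ (depth_ge_point C k0 sH).
have [p [q [pq H'p H'q e]]] := exists_crossing_edge medM H's H't.
have [Hp|/sH] := pselect (H p); last by lia.
case: neq; rewrite (halfspace_crossing medM hH' pq H'p H'q).
by apply: (halfspace_crossing medM hH pq Hp) => /HH'.
Qed.

Lemma depth_ge1 C H s : C s -> H s -> depth_ge C H 1.
Proof.
move=> Cs Hs; exists s => // t Ht; apply: (dist_gt0 connM) => st.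
by apply: Ht; rewrite -st.
Qed.

Lemma depth_ge_bounded C H D t k :
  diam_le C D -> C t -> ~ H t -> depth_ge C H k -> k <= D.
Proof.
by move=> CD Ct Ht [s Cs sH]; apply: leq_trans (sH t Ht) (CD _ _ Cs Ct).
Qed.

Lemma center_sub C : center C `<=` C.
Proof. by move=> z []. Qed.

Lemma center_convex C : convex C -> convex (center C).
Proof.
move=> cC u v w [Cu Hu] [Cv Hv] uwv; split; first exact: (cC u v).
by move=> H hH dH; apply: (halfspace_convex medM hH) uwv; [apply: Hu|apply: Hv].
Qed.

(** Helly applies to [C] and the deeper sides, with [C] as the bounded member. *)
Lemma center_nonempty C D : convex C -> C !=set0 -> diam_le C D ->
  center C !=set0.
Proof.
move=> cC [c Cc] CD.
have dge0 H : depth_ge C H 0 by exists c.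
(* The threshold cannot be 0, which every depth reaches; a positive one puts its witness inside
   [A]. *)
have CA A : deeper_side C A -> exists s, C s /\ A s.
  move=> [[|k] [s Cs sA] nA]; first by case: nA; apply: dge0.
  by exists s; split=> //; apply: (depth_ge_point C) sA.
have [||||z zF] := @helly_bounded _ medM
    [set A | A = C \/ halfspace A /\ deeper_side C A] C D.
- by move=> A [->//|[hA _]]; apply: halfspace_convex.
- move=> A B [->|[hA dA]] [->|[hB dB]].
  + by exists c.
  + by have [s] := CA B dB; exists s.
  + by have [s [Cs As]] := CA A dA; exists s.
  (* If [A] and [B] were disjoint, each would lie in the complement of the other. The larger
     threshold then bounds the depth of a complement from below, against the choice of the smaller
     one. *)
  apply: contrapT => AB0.
  have AB x : A x -> ~ B x by move=> Ax Bx; apply: AB0; exists x.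
  have [k Ak nAk] := dA; have [l Bl nBl] := dB.
  have AB' : A `<=` ~` B by [].
  have BA' : B `<=` ~` A by move=> x Bx /AB.
  have [lk|kl] := leqP l k.
    by apply: nBl; apply: depth_ge_leq lk (depth_ge_subset AB' Ak).
  by apply: nAk; apply: depth_ge_leq (ltnW kl) (depth_ge_subset BA' Bl).
- by left.
- exact: CD.
by exists z; split=> [|H hH dH]; apply: zF; [left|right].
Qed.

Definition cuts H C : Prop := H `&` C !=set0 /\ ~` H `&` C !=set0.

Lemma cutsC H C : cuts H C -> cuts (~` H) C.
Proof. by case=> H1 H2; split; rewrite ?setCK. Qed.

(** A point of the centre outside [H] shows that [H] is not strictly deeper than its complement. *)
Lemma center_balanced C H k : halfspace H -> cuts H (center C) ->
  depth_ge C H k -> depth_ge C (~` H) k.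
Proof.
move=> hH [_ [z [nHz [_ zC]]]] Hk; apply: contrapT => nHk.
by apply: nHz; apply: zC => //; exists k.
Qed.

(* If [H] and [H'] were disjoint, the depth would strictly increase along
   H < ~H', H' < ~H, while balancedness equates the depths of H, ~H and of
   H', ~H'. *)
Lemma center_cuts_meet C D H H' : diam_le C D -> halfspace H -> halfspace H' ->
  cuts H (center C) -> cuts H' (center C) -> H <> ~` H' -> H `&` H' !=set0.
Proof.
move=> CD hH hH' cH cH' neq; apply: contrapT => HH'0.
have HH' : H `<=` ~` H' by move=> x Hx H'x; apply: HH'0; exists x.
have H'H : H' `<=` ~` H by move=> x H'x Hx; apply: HH'0; exists x.
have neq' : H' <> ~` H by move=> e; apply: neq; rewrite e setCK.
have hC := halfspaceC medM hH; have hC' := halfspaceC medM hH'.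
have step k : 0 < k -> depth_ge C H k -> depth_ge C H k.+2.
  move=> k0 Hk.
  have := depth_ge_proper hH hC' HH' neq k0 Hk.
  move/(center_balanced hC' (cutsC cH')); rewrite setCK.
  move/(depth_ge_proper hH' hC H'H neq' (ltn0Sn _)).
  by move/(center_balanced hC (cutsC cH)); rewrite setCK.
have [[x [Hx [Cx _]]] [y [nHy [Cy _]]]] := cH.
have all n : depth_ge C H n.*2.+1.
  elim: n => [|n IH]; first exact: depth_ge1 Cx Hx.
  by rewrite doubleS; apply: step.
by have := depth_ge_bounded CD Cy nHy (all D); rewrite -addnn; lia.
Qed.

End Center.

(** * Halfspaces as coordinates: distances and cubes *)

Section CubesFromHalfspaces.
Variable M : graph.
Hypothesis medM : median_graph M.
Local Notation connM := (median_connected medM).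
Implicit Types (u v : M) (Z H : set M) (n D : nat).

(** A geodesic from [u] to [v] leaves each of the halfspaces along some edge, and an edge determines
    the halfspace that it leaves. *)
Lemma separating_halfspaces_le (I : finType) (Hs : I -> set M) u v :
  (forall i, halfspace (Hs i)) -> injective Hs ->
  (forall i, Hs i u /\ ~ Hs i v) -> #|I| <= dist u v.
Proof.
move=> hH injH sepH; have [c [c0 cn cadj]] := geodesic_param connM u v.
have cross i : exists j : 'I_(dist u v), Hs i (c j) /\ ~ Hs i (c j.+1).
  have [Hu Hv] := sepH i; apply: contrapT => no.
  suff all k : k <= dist u v -> Hs i (c k) by apply: Hv; rewrite -cn; apply: all.
  elim: k => [|k IH] kle; first by rewrite c0.
  apply: contrapT => nH; apply: no; exists (Ordinal kle); split=> //.
  exact/IH/ltnW.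
have [j jP] := choice cross.
have j_inj : injective j.
  move=> i i' ji; apply: injH; have [H1 H2] := jP i; have [H3 H4] := jP i'.
  rewrite ji in H1 H2; have e := cadj _ (ltn_ord (j i')).
  rewrite (halfspace_crossing medM (hH i) e H1 H2).
  by rewrite (halfspace_crossing medM (hH i') e H3 H4).
by have := leq_card j j_inj; rewrite card_ord.
Qed.

(** Each edge of a geodesic contributes one halfspace; with [separating_halfspaces_le], the distance
    is the exact number of separating halfspaces. *)
Lemma geodesic_halfspaces u v : exists Hs : 'I_(dist u v) -> set M,
  [/\ forall i, halfspace (Hs i), injective Hs
    & forall i, Hs i u /\ ~ Hs i v].
Proof.
suff [Hs [hH injH sepH]] : exists Hs : nat -> set M,
    [/\ forall i, i < dist u v -> halfspace (Hs i),
        forall i j, i < dist u v -> j < dist u v -> Hs i = Hs j -> i = j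
      & forall i, i < dist u v -> Hs i u /\ ~ Hs i v].
  exists (fun i => Hs i); split=> [i|i j e|i]; [exact: hH| |exact: sepH].
  by apply: ord_inj; apply: injH.
have [n uvn] : exists n, dist u v = n by exists (dist u v).
rewrite uvn; elim: n u uvn => [|n IH] u uvn; first by exists (fun=> set0).
have [z uz zv] := dist_step connM uvn.
have [Hs [hH injH sepH]] := IH z zv.
(* Were [u] outside, convexity of the complement would put [z], which lies between [u] and [v],
   outside too. *)
have Hsu i : i < n -> Hs i u.
  move=> ilt; have [Hz Hv] := sepH i ilt; apply: contrapT => Hu.
  have cH := halfspace_convex medM (halfspaceC medM (hH i ilt)).
  by apply: (cH u v z Hu Hv _ Hz); rewrite (dist_adj connM uz) uvn zv.
have Hs0 i : i < n -> Hs i <> convex_halfspace u z.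
  move=> ilt e; have [] := sepH i ilt; rewrite e /convex_halfspace /=.
  by rewrite distxx.
exists (fun i => if i is j.+1 then Hs j else convex_halfspace u z); split.
- by case=> [_|i /hH//]; exists u, z.
- case=> [|i] [|j] //= ilt jlt.
  + by move=> /esym /(Hs0 _ jlt).
  + by move=> /(Hs0 _ ilt).
  + by move=> /injH->.
- case=> [_|i ilt]; last by split; [apply: Hsu | case: (sepH i ilt)].
  rewrite /convex_halfspace /= distxx (dist_adj connM uz); split=> //.
  by rewrite !(dist_sym connM v) uvn zv; lia.
Qed.

Definition side H (b : bool) : set M := if b then H else ~` H.

Lemma halfspace_side H b : halfspace H -> halfspace (side H b).
Proof. by case: b => //; apply: halfspaceC. Qed.

Lemma cuts_side H b Z : cuts H Z -> cuts (side H b) Z.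
Proof. by case: b => //; apply: cutsC. Qed.

(** In unoriented terms, the indices name distinct hyperplanes. *)
Definition pairwise_unparallel n (Hs : 'I_n -> set M) : Prop :=
  forall i j, i != j -> Hs i <> Hs j /\ Hs i <> ~` Hs j.

Definition cutting_family Z n (Hs : 'I_n -> set M) : Prop :=
  [/\ forall i, halfspace (Hs i), forall i, cuts (Hs i) Z
    & pairwise_unparallel Hs].

(** [Z] will be a centre, with [cutsZ] supplied by [center_cuts_meet]. Applied to both sides of each
    halfspace, [cutsZ] makes non-parallel halfspaces that cut [Z] cross. *)
Variables (Z : set M) (D : nat).
Hypothesis cvxZ : convex Z.
Hypothesis Z0 : Z !=set0.
Hypothesis diamZ : diam_le Z D.
Hypothesis cutsZ : forall H H', halfspace H -> halfspace H' ->
  cuts H Z -> cuts H' Z -> H <> ~` H' -> H `&` H' !=set0.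

(** Helly for [Z] and the chosen sides: these meet [Z] by [cuts], and one another by [cutsZ]. *)
Lemma cutting_family_corner n (Hs : 'I_n -> set M) (a : {ffun 'I_n -> bool}) :
  cutting_family Z Hs -> exists2 z, Z z & forall i, side (Hs i) (a i) z.
Proof.
move=> [hH cH uH].
have [||||z zF] := @helly_bounded _ medM
    [set A | A = Z \/ exists i, A = side (Hs i) (a i)] Z D.
- move=> A [->//|[i ->]].
  by apply: (halfspace_convex medM); apply: halfspace_side.
- have meet i : side (Hs i) (a i) `&` Z !=set0 by have [] := cuts_side (a i) (cH i).
  move=> A B [->|[i ->]] [->|[j ->]].
  + by have [z Zz] := Z0; exists z.
  + by rewrite setIC.
  + by [].
  have [->|/uH[ij ij']] := eqVneq i j.
    by have [z [? ?]] := meet j; exists z.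
  apply: cutsZ; try exact: halfspace_side; try exact: cuts_side.
  by case: (a i) (a j) => -[] //= e; [apply: ij|apply: ij|apply: ij'] => //;
    rewrite -?e ?setCK // -[LHS]setCK e ?setCK.
- by left.
- exact: diamZ.
by exists z => [|i]; apply: zF; [left|right; exists i].
Qed.

(** The all-true and the all-false corners are separated by all [n] halfspaces. *)
Lemma cutting_family_dim n (Hs : 'I_n -> set M) : cutting_family Z Hs -> n <= D.
Proof.
move=> cf; have [hH cH uH] := cf.
have [u Zu Hu] := cutting_family_corner [ffun=> true] cf.
have [v Zv Hv] := cutting_family_corner [ffun=> false] cf.
apply: leq_trans (diamZ Zu Zv); rewrite -(card_ord n).
apply: (@separating_halfspaces_le _ Hs) => //.
  by move=> i j e; apply/eqP/negPn/negP => /uH[].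
by move=> i; have := Hu i; have := Hv i; rewrite !ffunE.
Qed.

Lemma cutting_family_maximal : exists n (Hs : 'I_n -> set M),
  cutting_family Z Hs /\
  forall H, halfspace H -> cuts H Z -> exists i, H = Hs i \/ H = ~` Hs i.
Proof.
have [||n [Hs cf] nmax] :=
    @max_exists (fun n => exists Hs : 'I_n -> set M, cutting_family Z Hs) D.
- by exists (fun=> set0); split=> -[].
- by move=> n [Hs /cutting_family_dim].
exists n, Hs; split=> // H hH cH; apply: contrapT => noH.
have [hHs cHs uHs] := cf.
suff /nmax : exists Hs' : 'I_n.+1 -> set M, cutting_family Z Hs' by rewrite ltnn.
exists (fun i => if unlift ord0 i is Some j then Hs j else H); split=> [i|i|i j].
- by case: unliftP.
- by case: unliftP.
case: unliftP => [i' ->|->]; case: unliftP => [j' ->|->] ij.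
- by apply: uHs; apply: contraNneq ij => ->.
- split=> e; apply: noH; exists i'; [left|right] => //.
  by rewrite e setCK.
- by split=> e; apply: noH; exists j'; [left|right].
- by rewrite eqxx in ij.
Qed.

(** A maximal cutting family supplies the coordinates: sign patterns correspond to the points of
    [Z]. *)
Lemma crossing_convex_cube : exists2 n, n <= D & is_cube n Z.
Proof.
have [n [Hs [cf maxH]]] := cutting_family_maximal.
have [hH cH uH] := cf; exists n; first exact: cutting_family_dim cf.
have corner (a : {ffun 'I_n -> bool}) :
    exists z, Z z /\ forall i, side (Hs i) (a i) z.
  by have [z] := cutting_family_corner a cf; exists z.
have [phi phiP] := choice corner.
have phi_side a i : Hs i (phi a) <-> a i.
  by have [_ /(_ i)] := phiP a; rewrite /side; case: (a i).
have phi_inj : injective phi.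
  move=> a b e; apply/ffunP => i; apply/idP/idP => /phi_side.
    by rewrite e => /phi_side.
  by rewrite -e => /phi_side.
(* A halfspace separating two points of [Z] cuts [Z], so up to complement it is in the maximal
   family; but there the signs of the two points agree. *)
have phi_range z : Z z -> phi [ffun i => `[< Hs i z >]] = z.
  move=> Zz; set a := finfun _; apply: contrapT.
  move=> /(halfspace_separation medM)[H [hH' Ha Hz]].
  have cHZ : cuts H Z.
    by split; [exists (phi a); split=> //; case: (phiP a) | exists z].
  have aE i : Hs i (phi a) <-> Hs i z.
    by rewrite phi_side /a ffunE; split=> /asboolP.
  have [i [e|e]] := maxH H hH' cHZ; subst H.
    by apply: Hz; apply/aE.
  by apply: Hz => /aE.
exists phi; split=> //; last first.
  apply/seteqP; split=> [z [a _ <-]|z Zz]; first by case: (phiP a).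
  by exists [ffun i => `[< Hs i z >]]; rewrite ?phi_range.
(* An edge leaves only one halfspace up to complement, so adjacent corners differ in one sign. *)
move=> a b; apply/idP/idP => [ab|].
  have [i abi] : exists i, a i != b i.
    apply: contrapT => no; apply: (adj_neq ab); congr phi; apply/ffunP => i.
    by apply/eqP/negPn/negP => abi; apply: no; exists i.
  apply/card1P; exists i => j; rewrite !inE.
  apply/idP/eqP => [abj|->//]; apply: contrapT => /eqP /uH[].
  have edge k : a k != b k -> Hs k = side (convex_halfspace (phi a) (phi b)) (a k).
    move: (phi_side a k) (phi_side b k).
    case: (a k) (b k) => -[] // [A1 A2] [B1 B2] _; rewrite /side.
      by apply: halfspace_crossing; [| |exact: ab|apply: A2|move/B1].
    rewrite (convex_halfspaceC medM ab); apply: halfspace_crossing => //.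
    - by rewrite adj_sym.
    - exact: B2.
    - by move/A1.
  rewrite (edge i abi) (edge j abj) /side.
  by case: (a i) (a j) => -[] n1 n2; rewrite ?setCK in n2.
(* Conversely, if only sign [i] differs, the first step [z] of a geodesic stays in [Z], keeps the
   common signs and differs from [a] at [i]; so it is the corner of [b]. *)
case/card1P=> i iP.
have abi : a i != b i by have := iP i; rewrite !inE eqxx.
have abj j : j != i -> a j = b j.
  by move=> ji; have := iP j; rewrite !inE (negPf ji) => /negbFE/eqP.
have ab : phi a <> phi b by move/phi_inj => e; rewrite e eqxx in abi.
have [Za _] := phiP a; have [Zb _] := phiP b.
have := dist_gt0 connM ab; case m: (dist _ _) => [//|k] _.
have [z az zb] := dist_step connM m.
have abz : dist (phi a) z + dist z (phi b) = dist (phi a) (phi b).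
  by rewrite (dist_adj connM az) zb m.
have zE := phi_range z (cvxZ Za Zb abz); set c := finfun _ in zE.
suff <- : c = b by rewrite zE.
have caj j : j != i -> c j = a j.
  move=> ji; have zs : side (Hs j) (a j) z.
    apply: (halfspace_convex medM (halfspace_side (a j) (hH j))) abz.
      by have [_] := phiP a.
    by rewrite abj //; have [_] := phiP b.
  move: zs; rewrite -zE /side; have [A B] := phi_side c j.
  by case: (a j) => zs; [apply: A|apply/negP => /B].
have cai : c i != a i.
  apply/eqP => cai; apply: (adj_neq az); rewrite -zE; congr phi.
  by apply/ffunP => j; have [->|/caj] := eqVneq j i.
apply/ffunP => j; have [->|ji] := eqVneq j i; last by rewrite caj // abj.
by move: cai abi; case: (c i) (a i) (b i) => -[] [].
Qed.

End CubesFromHalfspaces.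

(** * Cubes and distances in the first subdivision *)

Section CubesAndSubdivision.
Variable M : graph.
Hypothesis connM : connected_graph M.
Implicit Types (p q : M) (P Q : set M) (X Y : subdivision M).

Lemma is_cube0 p : is_cube 0 [set p].
Proof.
exists (fun=> p); split.
- by move=> a b _; apply/ffunP => -[].
- by move=> a b; rewrite adj_irr /cube_adj; apply/esym/card1P => -[[]].
- by apply/seteqP; split=> [x [_ _ <-]//|x ->]; exists [ffun=> true].
Qed.

Lemma is_cube1 p q : adj p q -> is_cube 1 [set p; q].
Proof.
move=> pq; have adjE (a b : {ffun 'I_1 -> bool}) : cube_adj a b = (a ord0 != b ord0).
  rewrite /cube_adj; apply/card1P/idP => [[i iE]|ab].
    by have := iE i; rewrite !inE eqxx (ord1 i).
  by exists ord0 => i; rewrite !inE (ord1 i) eqxx.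
exists (fun a : {ffun 'I_1 -> bool} => if a ord0 then p else q); split.
- move=> a b ab; apply/ffunP => i; rewrite (ord1 i); move: ab (adj_neq pq).
  by case: (a ord0) (b ord0) => -[] // ->.
- move=> a b; rewrite adjE; case: (a ord0) (b ord0) => -[] //=.
  + exact: adj_irr.
  + by rewrite adj_sym.
  + exact: adj_irr.
- apply/seteqP; split=> [x [a _ <-]|x [->|->]].
  + by case: ifP; [left|right].
  + by exists [ffun=> true]; rewrite ?ffunE.
  + by exists [ffun=> false]; rewrite ?ffunE.
Qed.

(** Fix coordinate 0 at its value in the sign vector of [p]. *)
Lemma cube_face n Q p : is_cube n.+1 Q -> Q p ->
  exists P, [/\ is_cube n P, P `<=` Q & P p].
Proof.
move=> [phi [phi_inj phi_adj <-]] [a _ <-].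
pose ext (c : {ffun 'I_n -> bool}) :=
  [ffun i => if unlift ord0 i is Some j then c j else a ord0].
exists (range (phi \o ext)); split.
- exists (phi \o ext); split=> //.
    move=> c c' /phi_inj/ffunP e; apply/ffunP => j.
    by have := e (lift ord0 j); rewrite !ffunE liftK.
  move=> c c'; rewrite /= phi_adj /cube_adj; congr (_ == 1).
  rewrite -!sum1_card big_mkcond big_ord_recl /= !inE !ffunE unlift_none eqxx.
  rewrite add0n [RHS]big_mkcond; apply: eq_bigr => j _.
  by rewrite !inE !ffunE liftK.
- by move=> x [c _ <-]; exists (ext c).
exists [ffun j => a (lift ord0 j)] => //=; congr phi; apply/ffunP => i.
by rewrite ffunE; case: unliftP => [j ->|->]; rewrite ?ffunE.
Qed.

Lemma cube_nonempty n Q : is_cube n Q -> Q !=set0.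
Proof. by move=> [phi [_ _ <-]]; exists (phi [ffun=> true]), [ffun=> true]. Qed.

Definition flip n (i : 'I_n) (a : {ffun 'I_n -> bool}) : {ffun 'I_n -> bool} :=
  [ffun j => if j == i then ~~ a i else a j].

Lemma cube_adj_flip n (i : 'I_n) a : cube_adj a (flip i a).
Proof.
apply/card1P; exists i => j; rewrite !inE ffunE.
by have [->|] := eqVneq j i; [case: (a i)|rewrite eqxx].
Qed.

Lemma card_diff_flip n (i : 'I_n) (a b : {ffun 'I_n -> bool}) : a i != b i ->
  #|[pred j | a j != b j]| = #|[pred j | flip i a j != b j]|.+1.
Proof.
move=> abi; rewrite (cardD1 i) inE abi add1n; congr _.+1.
apply: eq_card => j; rewrite !inE ffunE; have [->|] //= := eqVneq j i.
by move: abi; case: (a i) (b i) => -[].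
Qed.

(** Change the differing coordinates one at a time. *)
Lemma cube_diam n Q : is_cube n Q -> diam_le Q n.
Proof.
move=> [phi [_ phi_adj <-]] _ _ [a _ <-] [b _ <-].
suff le k : #|[pred i | a i != b i]| = k -> dist (phi a) (phi b) <= k.
  by apply: leq_trans (le _ erefl) _; rewrite -[X in _ <= X]card_ord max_card.
elim: k a => [|k IH] a abk.
  suff -> : a = b by rewrite distxx.
  apply/ffunP => i; apply/eqP/negPn; apply/negP => abi.
  by have := card0_eq abk i; rewrite inE abi.
have [i abi] : exists i, a i != b i.
  have /card_gt0P[i] : 0 < #|[pred i | a i != b i]| by rewrite abk.
  by rewrite inE => abi; exists i.
apply: leq_trans (dist_triangle connM (phi (flip i a)) _ _) _.
rewrite dist_adj ?phi_adj ?cube_adj_flip // add1n ltnS; apply: IH.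
by apply: succn_inj; rewrite -card_diff_flip.
Qed.

Definition vertex_cube p : subdivision M :=
  exist _ [set p] (ex_intro _ 0 (is_cube0 p)).

(** Descend through faces containing [p], losing one dimension per step. *)
Lemma cube_walk_to_vertex n X p : is_cube n (sval X) -> sval X p ->
  exists2 w, walk X (vertex_cube p) w & size w = n.
Proof.
elim: n X => [|n IH] X cX Xp.
  exists [::] => //; split=> //=; apply: cube_eq => /=.
  have d0 := cube_diam cX; apply/seteqP; split=> [x Xx|x ->//].
  by apply: (dist0_eq connM); apply/eqP; rewrite -leqn0; apply: d0.
have [P [cP PX Pp]] := cube_face cX Xp.
pose Y : subdivision M := exist _ P (ex_intro _ n cP).
have [w [Yw wp] <-] := IH Y cP Pp; exists (Y :: w) => //; split=> //=.
rewrite Yw andbT; apply/asboolP; exists n.+1, n; split=> //; by right.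
Qed.

(** Every edge of [M] costs two steps, through its 1-cube. *)
Lemma vertex_walk p q :
  exists2 w, walk (vertex_cube p) (vertex_cube q) w & size w = (dist p q).*2.
Proof.
have [k pqk] : exists k, dist p q = k by exists (dist p q).
rewrite pqk; elim: k p pqk => [|k IH] p pqk.
  by exists [::] => //; rewrite (dist0_eq connM pqk).
have [z pz zq] := dist_step connM pqk; have [w [zw wq] wk] := IH z zq.
pose Y : subdivision M := exist _ [set p; z] (ex_intro _ 1 (is_cube1 pz)).
exists (Y :: vertex_cube z :: w); last by rewrite /= wk.
split=> //=; rewrite zw andbT; apply/andP; split; apply/asboolP.
  exists 0, 1; split; [exact: is_cube0|exact: is_cube1| |by left].
  by left=> x /= ->; left.
exists 1, 0; split; [exact: is_cube1|exact: is_cube0| |by right].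
by right=> x /= ->; right.
Qed.

Lemma cube_walk m n X Y p q : is_cube m (sval X) -> is_cube n (sval Y) ->
  sval X p -> sval Y q ->
  exists2 w, walk X Y w & size w = m + (dist p q).*2 + n.
Proof.
move=> cX cY Xp Yq.
have [w1 wX <-] := cube_walk_to_vertex cX Xp.
have [w2 wpq <-] := vertex_walk p q.
have [w3 /walk_rev[w4 wY <-] <-] := cube_walk_to_vertex cY Yq.
exists (w1 ++ w2 ++ w4); last by rewrite !size_cat addnA.
exact: walk_cat wX (walk_cat wpq wY).
Qed.

Lemma subdivision_connected : connected_graph (subdivision M).
Proof.
move=> X Y; have [m cX] := svalP X; have [n cY] := svalP Y.
have [p Xp] := cube_nonempty cX; have [q Yq] := cube_nonempty cY.
by have [w wXY _] := cube_walk cX cY Xp Yq; exists w.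
Qed.

Lemma subdivision_dist_le m n X Y p q :
  is_cube m (sval X) -> is_cube n (sval Y) -> sval X p -> sval Y q ->
  dist X Y <= m + (dist p q).*2 + n.
Proof.
move=> cX cY Xp Yq; have [w wXY <-] := cube_walk cX cY Xp Yq.
exact: dist_le_walk wXY.
Qed.

Lemma adjacent_cubes X Y p : adj X Y -> sval X p -> exists m n q,
  [/\ is_cube m (sval X), is_cube n (sval Y), sval Y q,
      dist p q <= m & n <= m.+1].
Proof.
move=> /asboolP[m [n [cX cY XY mn]]] Xp; exists m, n.
case: XY => [XY|YX]; first by exists p; split=> //; [exact: XY|rewrite distxx|lia].
have [q Yq] := cube_nonempty cY; exists q; split=> //; last by lia.
by apply: (cube_diam cX) => //; apply: YX.
Qed.

(** Leaving a cube of dimension [j] moves the chosen vertex by at most [j], and dimensions grow by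
    at most 1 per step, so each cube on the walk contributes at most [m + dist X Y]. *)
Lemma subdivision_dist_ge m X Y p q :
  is_cube m (sval X) -> sval X p -> sval Y q ->
  dist p q <= (dist X Y).+1 * (m + dist X Y).
Proof.
have [w [wXY <-]] := geodesic_exists subdivision_connected X Y.
elim: w m X p wXY => [|Z w IH] m X p [/= wX wY] cX Xp Yq.
  by subst; have := cube_diam cX Xp Yq; lia.
move/andP: wX => [XZ wZ].
have [m' [n [z [cX' cZ Zz pz nm]]]] := adjacent_cubes XZ Xp.
rewrite (is_cube_dim cX' cX) in pz nm.
have zq := IH n Z z (conj wZ wY) cZ Zz Yq.
apply: leq_trans (dist_triangle connM z p q) _; rewrite /= [leqRHS]mulSn.
apply: leq_add; first exact: leq_trans pz (leq_addr _ _).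
by apply: leq_trans zq _; rewrite leq_mul2l addnS -addSn leq_add2r nm orbT.
Qed.

(** With bounded dimension the bound becomes linear, as a quasi-isometry requires. *)
Lemma subdivision_dist_ge_bounded N X Y p q :
  (forall n Q, is_cube n Q -> n <= N) -> sval X p -> sval Y q ->
  dist p q <= (dist X Y).+1 * N.
Proof.
move=> dimN; have [w [wXY <-]] := geodesic_exists subdivision_connected X Y.
elim: w X p wXY => [|Z w IH] X p [/= wX wY] Xp Yq.
  subst; have [m cY] := svalP Y; rewrite mul1n.
  exact: leq_trans (cube_diam cY Xp Yq) (dimN _ _ cY).
move/andP: wX => [XZ wZ].
have [m [n [z [cX _ Zz pz _]]]] := adjacent_cubes XZ Xp.
apply: leq_trans (dist_triangle connM z p q) _; rewrite /= [leqRHS]mulSn.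
exact: leq_add (leq_trans pz (dimN _ _ cX)) (IH Z z (conj wZ wY) Zz Yq).
Qed.

End CubesAndSubdivision.

(** * Invariance under the group action *)

Section ActionInvariance.
Variables (Gamma : groupType) (X : ggraph Gamma).
Hypothesis connX : connected_graph X.
Implicit Types (g : Gamma) (x y : X) (C H : set X).
Local Open Scope group_scope.

Lemma actK g : cancel (@act _ X g) (act g^-1).
Proof. by move=> x; rewrite -actM mulVg act1. Qed.

Lemma actVK g : cancel (@act _ X g^-1) (act g).
Proof. by move=> x; rewrite -actM mulgV act1. Qed.

Lemma dist_act g x y : dist (act g x) (act g y) = dist x y.
Proof.
have le h (a b : X) : (dist (act h a) (act h b) <= dist a b)%N.
  have [p [[ap pb] <-]] := geodesic_exists connX a b.
  rewrite -(size_map (act h)); apply: dist_le_walk.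
  split; last by rewrite last_map pb.
  elim: p a ap {pb} => //= c p IH a /andP[ac cp].
  by rewrite act_adj ac IH.
apply/eqP; rewrite eqn_leq le /=.
by have := le g^-1 (act g x) (act g y); rewrite !actK.
Qed.

Lemma halfspace_act g H : halfspace H -> halfspace (act g @^-1` H).
Proof.
move=> [u [v [uv ->]]]; exists (act g^-1 u), (act g^-1 v); split.
  by rewrite act_adj.
apply/seteqP; split=> w; rewrite /convex_halfspace /=.
  by rewrite -(dist_act g w) -(dist_act g w (act _ v)) !actVK.
by rewrite -(dist_act g w) -(dist_act g w (act _ v)) !actVK.
Qed.

Lemma depth_ge_act g C H k :
  depth_ge (act g @` C) H k <-> depth_ge C (act g @^-1` H) k.
Proof.
split=> [[_ [s Cs <-] sH]|[s Cs sH]].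
  by exists s => // t /sH; rewrite dist_act.
exists (act g s); first by exists s.
by move=> t Ht; rewrite -{1}(actVK g t) dist_act; apply: sH; rewrite /= actVK.
Qed.

Lemma center_act g C : center (act g @` C) = act g @` center C.
Proof.
(* One inclusion for all [h] and [B] suffices; the inverse of [g] gives the other one. *)
have sub (h : Gamma) (B : set X) : act h @` center B `<=` center (act h @` B).
  move=> _ [z [Bz zB] <-]; split; first by exists z.
  move=> H hH [k Hk nHk]; suff : (act h @^-1` H) z by [].
  apply: (zB _ (halfspace_act h hH)).
  exists k; first exact/depth_ge_act.
  by rewrite preimage_setC => /depth_ge_act.
apply/seteqP; split; last exact: sub.
move=> z zC; exists (act g^-1 z); last exact: actVK.
suff <- : act g^-1 @` (act g @` C) = C by apply: sub; exists z.
apply/seteqP; split=> [_ [_ [x Cx <-] <-]|x Cx]; first by rewrite actK.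
by exists (act g x); [exists x|rewrite actK].
Qed.

End ActionInvariance.

(** * Coarse maps with natural-number constants *)

Section CoarseMapBounds.
Variables (R : realType) (X Y : graph) (f : X -> Y).
Import Order.TTheory GRing.Theory Num.Theory.
Local Open Scope ring_scope.

Lemma coarse_embedding_intro (A : nat) :
  (forall x y, (dist (f x) (f y) <= A * dist x y + A)%N) ->
  (forall n : nat, exists B : nat,
     forall x y, (dist (f x) (f y) <= n)%N -> (dist x y <= B)%N) ->
  coarse_embedding R f.
Proof.
move=> upper /choice[B lower].
(* The sum makes [S] monotone and at least [B]; the added [n] makes it unbounded, so that it has a
   generalised inverse. *)
pose S n := (\sum_(k < n.+1) B k + n)%N.
have S_ge n : (n <= S n)%N by rewrite leq_addl.
have B_S n : (B n <= S n)%N by rewrite /S big_ord_recr /=; lia.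
have S_mono m n : (m <= n)%N -> (S m <= S n)%N.
  apply: (homo_leq leqnn (fun _ _ _ => @leq_trans _ _ _)) => k.
  by rewrite /S [in leqRHS]big_ord_recr /= -addnA leq_add2l addnS ltnW // ltnS leq_addl.
have ex m : exists n, (m <= S n)%N by exists m.
(* The lower control sends [m] to the least [n] with [m <= S n]; the constant [A.+1] is at least 1
   even when [A] is 0. *)
exists A.+1%:R, (fun m => ex_minn (ex m)); split.
- by rewrite ler1n.
- move=> m n mn; case: ex_minnP => i _ imin; case: ex_minnP => j nj _.
  by apply: imin; apply: leq_trans mn nj.
- move=> N; exists (S N).+1 => n Nn; case: ex_minnP => i ni _.
  rewrite leqNgt; apply/negP => /ltnW/S_mono iN.
  by have := leq_trans Nn (leq_trans ni iN); rewrite ltnn.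
move=> x y; split.
  rewrite -natrM -natrD ler_nat; apply: leq_trans (upper x y) _.
  by rewrite leq_add // leq_mul.
case: ex_minnP => i _; apply; apply: leq_trans (B_S _); exact: lower.
Qed.

Lemma coarse_embedding_upper : coarse_embedding R f ->
  exists A : nat, forall x y, (dist (f x) (f y) <= A * dist x y + A)%N.
Proof.
move=> [K [rho [K1 _ _ fP]]]; have K0 : 0 <= K by apply: le_trans K1.
exists (Num.bound K) => x y; have [up _] := fP x y.
rewrite -(ler_nat R) natrD natrM; apply: le_trans up _.
have KA := ltW (archi_boundP K0).
by apply: lerD => //; apply: ler_wpM2r.
Qed.

Lemma coarse_embedding_lower : coarse_embedding R f ->
  forall n : nat, exists B : nat,
    forall x y, (dist (f x) (f y) <= n)%N -> (dist x y <= B)%N.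
Proof.
move=> [K [rho [_ _ rho_inf fP]]] n.
have [n0 n0P] := rho_inf n.+1; exists n0 => x y fxy.
rewrite leqNgt; apply/negP => /ltnW/n0P rn.
have [_ low] := fP x y.
by have := leq_trans rn (leq_trans low fxy); rewrite ltnn.
Qed.

Lemma quasi_isometry_intro (B C : nat) : coarse_embedding R f ->
  (forall x y, (dist x y <= B * dist (f x) (f y) + B)%N) ->
  (forall y, exists x, (dist y (f x) <= C)%N) ->
  quasi_isometry R f.
Proof.
move=> ce lower dense; split=> //.
  exists B.+1%:R; first by rewrite ler1n.
  move=> x y; rewrite lerBlDr ler_pdivrMr ?ltr0n // -natrD -natrM ler_nat.
  apply: leq_trans (lower x y) _; nia.
exists C%:R; first exact: ler0n.
by move=> y; have [x xC] := dense y; exists x; rewrite ler_nat.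
Qed.

Lemma quasi_isometry_dense : quasi_isometry R f ->
  exists C : nat, forall y, exists x, (dist y (f x) <= C)%N.
Proof.
move=> [_ _ [K K0 dense]]; exists (Num.bound K) => y.
have [x xK] := dense y; exists x.
by rewrite -(ler_nat R); apply: le_trans xK (ltW (archi_boundP K0)).
Qed.

End CoarseMapBounds.

(** * Theta-classes, halfspaces and crossing *)

Section ThetaClassesAsHalfspaces.
Variable M : graph.
Hypothesis medM : median_graph M.
Local Notation connM := (median_connected medM).
Implicit Types (H : set M) (h : set (M * M)).

(** For halfspaces [H] these are exactly the Theta-classes, by [theta_classP]. *)
Definition halfspace_class H : set (M * M) :=
  [set e | adj e.1 e.2 /\ (H e.1 /\ ~ H e.2)].

(** The differences of distances compared by [theta] are 1 or -1, by [dist_edge]; their sum is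
    positive only if both are 1. *)
Lemma thetaE (e e' : M * M) : oriented_edge e -> oriented_edge e' ->
  theta e' e <-> convex_halfspace e.1 e.2 e'.1 /\ ~ convex_halfspace e.1 e.2 e'.2.
Proof.
move=> /(dist_edge medM) d _; have := d e'.1; have := d e'.2.
rewrite /theta /convex_halfspace /=; lia.
Qed.

Lemma theta_classP h :
  theta_class h <-> exists2 H, halfspace H & h = halfspace_class H.
Proof.
have classE (e : M * M) : oriented_edge e ->
    [set e' | oriented_edge e' /\ theta e' e] =
    halfspace_class (convex_halfspace e.1 e.2).
  move=> edge; apply/seteqP; split=> e' [edge' ?]; split=> //.
    exact/thetaE.
  exact/thetaE.
split=> [[e edge ->]|[_ [u [v [uv ->]]] ->]].
  by exists (convex_halfspace e.1 e.2); [exists e.1, e.2|rewrite classE].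
by exists (u, v) => //; rewrite classE.
Qed.

Lemma halfspace_class_edge H : halfspace H -> exists e, halfspace_class H e.
Proof.
move=> [u [v [uv ->]]]; exists (u, v); rewrite /halfspace_class /convex_halfspace.
by rewrite /= !distxx (dist_adj connM uv).
Qed.

Lemma hplus_halfspace_class H : halfspace H -> hplus (halfspace_class H) = H.
Proof.
move=> hH; have side_e e : halfspace_class H e -> convex_halfspace e.1 e.2 = H.
  by move=> [edge [e1 e2]]; rewrite (halfspace_crossing medM hH edge).
apply/seteqP; split=> [w [e /side_e <-]//|w Hw].
have [e eH] := halfspace_class_edge hH; exists e => //.
by move: Hw; rewrite -(side_e e eH).
Qed.

Lemma hminus_halfspace_class H : halfspace H -> hminus (halfspace_class H) = ~` H.
Proof.
move=> hH; have side_e e : halfspace_class H e -> convex_halfspace e.2 e.1 = ~` H.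
  move=> [edge [e1 e2]]; rewrite (halfspace_crossing medM hH edge) //.
  by rewrite convex_halfspaceC.
apply/seteqP; split=> [w [e /side_e <-]//|w Hw].
have [e eH] := halfspace_class_edge hH; exists e => //.
by move: Hw; rewrite -(side_e e eH).
Qed.

Definition halfspaces_cross H H' : Prop :=
  [/\ H `&` H' !=set0, H `&` ~` H' !=set0,
      ~` H `&` H' !=set0 & ~` H `&` ~` H' !=set0].

(* The hypothesis is the body of [crossing_bounded M], so that the bound [N] is
   kept. *)
Lemma crossing_halfspaces_le (N : nat) :
  (forall S : set (set (M * M)), S `<=` @theta_class M ->
    (forall h h', S h -> S h' -> h <> h' -> crossing h h') -> S #<= `I_N) ->
  forall (I : finType) (Hs : I -> set M), (forall i, halfspace (Hs i)) ->
    injective Hs -> (forall i j, i != j -> halfspaces_cross (Hs i) (Hs j)) ->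
    #|I| <= N.
Proof.
move=> cbN I Hs hH injH crossH; pose cl i := halfspace_class (Hs i).
have cl_inj : injective cl.
  move=> i j ij; apply: injH.
  rewrite -(hplus_halfspace_class (hH i)) -(hplus_halfspace_class (hH j)).
  by rewrite -/(cl i) ij.
have /pcard_leP[f] : range cl #<= `I_N.
  apply: cbN => [_ [i _ <-]|_ _ [i _ <-] [j _ <-] ij].
    by apply/theta_classP; exists (Hs i).
  rewrite /crossing !hplus_halfspace_class ?hminus_halfspace_class //.
  by apply: crossH; apply/eqP => e; apply: ij; rewrite e.
have fN i : f (cl i) < N by apply: (funS (s := f)); exists i.
rewrite -(card_ord N); apply: (@leq_card _ _ (fun i => Ordinal (fN i))).
move=> i j [fij]; apply: cl_inj; apply: (inj (f := f)) => //.
all: by rewrite inE /=; eexists.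
Qed.

Lemma flipK n (i : 'I_n) : involutive (flip i).
Proof.
move=> a; apply/ffunP => j; rewrite !ffunE eqxx.
by have [->|//] := eqVneq j i; rewrite negbK.
Qed.

Lemma flipC n (i j : 'I_n) a : i != j -> flip i (flip j a) = flip j (flip i a).
Proof.
move=> ij; have ji : j == i = false by rewrite eq_sym (negPf ij).
apply/ffunP => k; rewrite /flip !ffunE (negPf ij) ji.
by have [->|] := eqVneq k i; rewrite ?(negPf ij).
Qed.

(** Induction on the number of true coordinates: resetting a true coordinate [j] passes to the
    opposite edge of a square. *)
Lemma cube_parallel_edges n (phi : {ffun 'I_n -> bool} -> M) (i : 'I_n)
    (a : {ffun 'I_n -> bool}) :
  injective phi -> (forall a b, adj (phi a) (phi b) = cube_adj a b) ->
  ~~ a i -> convex_halfspace (phi a) (phi (flip i a)) =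
    convex_halfspace (phi [ffun=> false]) (phi (flip i [ffun=> false])).
Proof.
move=> phi_inj phi_adj; have [k] : exists k, #|[pred j | a j]| = k by eexists.
elim: k a => [|k IH] a ak ai.
  suff -> : a = [ffun=> false] by [].
  by apply/ffunP => j; rewrite ffunE; have := card0_eq ak j; rewrite inE.
have /card_gt0P[j] : 0 < #|[pred j | a j]| by rewrite ak.
rewrite inE => aj; have ij : i != j by apply: contraTneq aj => <-.
have ji : j != i by rewrite eq_sym.
rewrite -(IH (flip j a)); last first.
- by rewrite ffunE (negPf ij).
- apply: succn_inj; rewrite -ak (cardD1 j [pred j | a j]) inE aj add1n; congr _.+1.
  apply: eq_card => l; rewrite !inE ffunE; have [->|//] := eqVneq l j.
  by rewrite aj.
apply: (square_halfspace medM).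
- by rewrite phi_adj cube_adj_flip.
- by rewrite phi_adj cube_adj_flip.
- by rewrite phi_adj flipC // -{2}(flipK j (flip i a)) cube_adj_flip.
- by rewrite phi_adj -{2}(flipK i a) cube_adj_flip.
- move/phi_inj/ffunP/(_ j); rewrite !ffunE eqxx (negPf ji) aj.
  by [].
- by move/phi_inj/ffunP/(_ j); rewrite !ffunE eqxx (negPf ji) aj.
Qed.

(** The [n] coordinate halfspaces of an [n]-cube cross pairwise, since all four sign combinations of
    two coordinates occur. *)
Lemma crossing_bounded_cube_dim : crossing_bounded M ->
  exists N, forall n Q, @is_cube M n Q -> n <= N.
Proof.
move=> [N cbN]; exists N => n Q [phi [phi_inj phi_adj _]].
pose Hs i := convex_halfspace (phi [ffun=> false]) (phi (flip i [ffun=> false])).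
have HsP i (a : {ffun 'I_n -> bool}) : Hs i (phi a) <-> ~~ a i.
  case ai: (a i); last first.
    rewrite /Hs -(@cube_parallel_edges _ phi i a) ?ai // /convex_halfspace /=.
    by rewrite distxx (dist_adj connM) // phi_adj cube_adj_flip.
  (* Here [phi a] is the far end of the edge that starts at [flip i a]. *)
  have bi : ~~ flip i a i by rewrite ffunE eqxx ai.
  rewrite /Hs -(@cube_parallel_edges _ phi i (flip i a)) // flipK.
  by rewrite /convex_halfspace /= distxx ltn0.
have corner i j (b b' : bool) : i != j ->
    exists x, (Hs i x <-> ~~ b) /\ (Hs j x <-> ~~ b').
  move=> ij; exists (phi [ffun k => if k == i then b else b']).
  by split; rewrite HsP ffunE ?eqxx // eq_sym (negPf ij).
rewrite -(card_ord n); apply: (crossing_halfspaces_le cbN (Hs := Hs)).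
- by move=> i; do 2 eexists; split; [|reflexivity]; rewrite phi_adj cube_adj_flip.
- move=> i j e; apply/eqP/negPn; apply/negP => /(corner i j true false)[x].
  by rewrite e => -[[A B] [C D]]; have := A (D isT).
move=> i j ij; split.
- by have [x [[_ A] [_ B]]] := corner i j false false ij;
    exists x; split; [apply: A|apply: B].
- by have [x [[_ A] [B _]]] := corner i j false true ij;
    exists x; split; [apply: A|move/B].
- by have [x [[A _] [_ B]]] := corner i j true false ij;
    exists x; split; [move/A|apply: B].
- by have [x [[A _] [B _]]] := corner i j true true ij;
    exists x; split; [move/A|move/B].
Qed.

End ThetaClassesAsHalfspaces.

(** * The equivariant map sending a vertex to the centre of its fibre *)

Section CentersOfFibres.
Variables (Gamma : groupType) (G M : ggraph Gamma).
Hypothesis connG : connected_graph G.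
Hypothesis medM : median_graph M.
Local Notation connM := (median_connected medM).
Variable beta : M -> set G.
Hypothesis decM : median_decomposition beta.
Hypothesis canM : canonical_decomposition beta.

Lemma center_cube (C : set M) D : convex C -> C !=set0 -> diam_le C D ->
  exists2 n, n <= D & is_cube n (center C).
Proof.
move=> cC C0 CD; apply: (crossing_convex_cube medM).
- exact: center_convex.
- exact: center_nonempty CD.
- by move=> x y /center_sub Cx /center_sub Cy; apply: CD.
- by move=> H H'; apply: (center_cuts_meet medM CD).
Qed.

Lemma fibre_act g x : fibre beta (act g x) = act g @` fibre beta x.
Proof.
apply/seteqP; split=> [u|_ [u ux <-]]; rewrite /fibre /=; last first.
  by rewrite -canM; exists x.
rewrite -[u in beta u](actVK g) -canM => -[y uy /act_inj yx].
by exists (act (g^-1)%g u); rewrite ?actVK // -yx.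
Qed.

Lemma fibre_convex x : convex (fibre beta x).
Proof. by have [_ _ cvx] := decM; apply/(convexP medM). Qed.

Lemma fibre_nonempty x : fibre beta x !=set0.
Proof.
have [cov _ _] := decM; have : [set: G] x by [].
by rewrite -cov => -[u _ ux]; exists u.
Qed.

Variable D : nat.
Hypothesis diam_fibre : forall x, diam_le (fibre beta x) D.

Lemma center_fibre_cube x : exists n, is_cube n (center (fibre beta x)).
Proof.
have [n _ cn] := center_cube (@fibre_convex x) (fibre_nonempty x) (@diam_fibre x).
by exists n.
Qed.

Definition fibre_center x : gsubdivision M :=
  exist _ (center (fibre beta x)) (center_fibre_cube x).

Lemma fibre_center_equivariant : equivariant fibre_center.
Proof.
move=> g x; apply: cube_eq => /=.
by rewrite fibre_act center_act //; apply: median_connected.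
Qed.

Lemma fibre_center_vertex x : exists2 p, sval (fibre_center x) p & beta p x.
Proof.
have [n cn] := center_fibre_cube x; have [p px] := cube_nonempty cn.
by exists p => //; apply: center_sub px.
Qed.

Lemma fibre_center_dim n x : is_cube n (sval (fibre_center x)) -> n <= D.
Proof.
have [m mD cm] := center_cube (@fibre_convex x) (fibre_nonempty x) (@diam_fibre x).
by move=> cn; rewrite (is_cube_dim cn cm).
Qed.

(** Vertices of the two centres are within [D + dist p q + D], as each shares a fibre with [p] or
    [q]. This counts twice in the subdivision, and the outer summands [D] bound the cube
    dimensions. *)
Lemma fibre_center_dist_le x y p q : beta p x -> beta q y ->
  dist (fibre_center x) (fibre_center y) <= D + (D + dist p q + D).*2 + D.
Proof.
move=> px qy; have [n cx] := center_fibre_cube x; have [m cy] := center_fibre_cube y.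
have [p' p'c p'x] := fibre_center_vertex x.
have [q' q'c q'y] := fibre_center_vertex y.
apply: leq_trans (@subdivision_dist_le _ connM _ _ (fibre_center x)
  (fibre_center y) _ _ cx cy p'c q'c) _.
have dx := @fibre_center_dim _ x cx; have dy := @fibre_center_dim _ y cy.
have := diam_fibre p'x px; have := diam_fibre qy q'y.
have := dist_triangle connM p p' q'; have := dist_triangle connM q p q'; lia.
Qed.

(** Adjacent vertices share a bag, so [fibre_center_dist_le] applies with [p = q] and gives [D * 6]
    per edge. *)
Lemma fibre_center_lipschitz x y :
  dist (fibre_center x) (fibre_center y) <= D * 6 * dist x y.
Proof.
have [k xyk] : exists k, dist x y = k by exists (dist x y).
rewrite xyk; elim: k x xyk => [|k IH] x xyk.
  by rewrite (dist0_eq connG xyk) distxx.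
have [z xz zy] := dist_step connG xyk.
have [_ edges _] := decM; have [u [ux uz]] := edges x z xz.
have := fibre_center_dist_le ux uz; have := IH z zy.
have connM' : connected_graph (gsubdivision M) := subdivision_connected connM.
have := dist_triangle connM' (fibre_center z) (fibre_center x) (fibre_center y).
rewrite distxx => t1 t2 t3; apply: leq_trans t1 _; rewrite [leqRHS]mulnS.
by apply: leq_add t2; apply: leq_trans t3 _; lia.
Qed.

Hypothesis suppM : properly_supported beta.

Lemma fibre_center_lower n : exists B, forall x y,
  dist (fibre_center x) (fibre_center y) <= n -> dist x y <= B.
Proof.
(* By [subdivision_dist_ge], with dimension at most [D], this radius around a vertex of the centre
   of [x] reaches the fibre of [y]. *)
have [B BP] := suppM (n.+1 * (D + n)); exists B => x y fxy.
have [m cx] := center_fibre_cube x.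
have [p pc px] := fibre_center_vertex x.
have [q qc qy] := fibre_center_vertex y.
apply: (BP p); first by exists p; rewrite ?distxx.
exists q => //; apply: leq_trans (@subdivision_dist_ge _ connM _ (fibre_center x)
  (fibre_center y) _ _ cx pc qc) _.
by apply: leq_mul => //; apply: leq_add => //; apply: (@fibre_center_dim _ x) cx.
Qed.

Lemma fibre_center_coarse_embedding (R : realType) :
  coarse_embedding R fibre_center.
Proof.
apply: (@coarse_embedding_intro _ _ _ _ (D * 6)); last exact: fibre_center_lower.
by move=> x y; apply: leq_trans (fibre_center_lipschitz x y) (leq_addr _ _).
Qed.

Variable r : nat.
Hypothesis dense : forall v, exists u, dist u v <= r /\ beta u !=set0.

(** Follow a geodesic from [p] to [q] and pick a vertex of [G] from a nonempty bag near each of its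
    vertices; consecutive picks are at distance at most [E]. *)
Lemma dist_le_fibres : exists E, forall x y p q, beta p x -> beta q y ->
  dist x y <= E * (dist p q).+1.
Proof.
(* Radius [r.+1] around [p] covers bags within [r] of [p] and bags within [r] of its neighbour
   [z]. *)
have [E EP] := suppM r.+1; exists E => x y p q px qy.
suff le k : dist p q = k -> forall x, (exists2 u, beta u x & dist p u <= r) ->
    dist x y <= E * k.+1.
  by apply: (le _ erefl x); exists p; rewrite ?distxx.
elim: k p {x px} => [|k IH] p pq x [u ux pu].
  rewrite muln1; apply: (EP p); first by exists u => //; apply: leqW.
  by exists q => //; rewrite pq.
have [z pz zq] := dist_step connM pq.
have [u' [u'z [x' u'x']]] := dense z.
have x'y := IH z zq x' (ex_intro2 _ _ u' u'x' _).
apply: leq_trans (dist_triangle connG x' x y) _; rewrite mulnS; apply: leq_add.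
  apply: (EP p); first by exists u => //; apply: leqW.
  exists u' => //; apply: leq_trans (dist_triangle connM z p u') _.
  by rewrite (dist_adj connM pz) add1n ltnS (dist_sym connM).
by apply: x'y; rewrite (dist_sym connM).
Qed.

Lemma fibre_center_quasi_isometry (R : realType) N :
  (forall n Q, @is_cube M n Q -> n <= N) -> quasi_isometry R fibre_center.
Proof.
move=> dimN; have [E EP] := dist_le_fibres.
(* The first constant combines [dist_le_fibres] with [subdivision_dist_ge_bounded]. In the second,
   [N] bounds the cube dimensions and [r + D] the distance from a vertex of a cube to a nearby
   centre. *)
apply: (@quasi_isometry_intro _ _ _ _ (E * N.+1) (N + (r + D).*2 + N)).
- exact: fibre_center_coarse_embedding.
- move=> x y; have [p pc px] := fibre_center_vertex x.
  have [q qc qy] := fibre_center_vertex y.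
  have pq := @subdivision_dist_ge_bounded _ connM _ (fibre_center x)
    (fibre_center y) _ _ dimN pc qc.
  apply: leq_trans (EP x y p q px qy) _; rewrite addnC -mulnS -mulnA.
  rewrite leq_mul2l; apply/orP; right; rewrite mulSn addSn ltnS.
  by apply: leq_trans pq _; rewrite mulnC leq_addl.
move=> Y; have [n cY] := svalP Y; have [q Yq] := cube_nonempty cY.
have [u [uq [x ux]]] := dense q; exists x.
have [p pc px] := fibre_center_vertex x; have [m cx] := center_fibre_cube x.
apply: leq_trans (@subdivision_dist_le _ connM _ _ Y (fibre_center x)
  _ _ cY cx Yq pc) _.
have := dimN _ _ cY; have := dimN _ _ cx; have := diam_fibre ux px.
by have := dist_triangle connM u q p; rewrite (dist_sym connM q u); lia.
Qed.

End CentersOfFibres.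

(** * Fibres of the pull-back decomposition *)

Lemma card_le_levels (I : finType) (l : I -> nat) (B N : nat) :
  (forall i, l i < B) -> (forall c, #|{: {i | l i == c}}| <= N) ->
  #|I| <= B * N.
Proof.
move=> lB cN; rewrite -sum1_card.
rewrite (partition_big (fun i => Ordinal (lB i)) predT) //=.
rewrite -[B in leqRHS]card_ord -sum_nat_const; apply: leq_sum => c _.
by have := cN c; rewrite card_sig -sum1_card.
Qed.

Section Pullback.
Variables G M : graph.
Hypothesis connG : connected_graph G.
Hypothesis medM : median_graph M.
Local Notation connM := (median_connected medM).
Variable f : G -> M.
Implicit Types (x y : G) (u v : M) (H : set M).

(* The fibre over [x] is the convex hull of the image of the closed
   neighbourhood of [x]. *)
Lemma pullbackP v x : pullback f v x <->
  forall H, halfspace H -> H v -> exists y, (y = x \/ adj y x) /\ H (f y).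
Proof.
split=> [vx H hH Hv|vx _ [/(theta_classP medM)[H hH ->]]]; last first.
  rewrite hplus_halfspace_class // => Hv.
  have [y [[<-|yx] Hy]] := vx H hH Hv; first by left.
  by right; exists y.
have [|Hx|[y Hy yx]] := vx (halfspace_class H).
- split; last by rewrite hplus_halfspace_class.
  by apply/(theta_classP medM); exists H.
- by exists x; split; [left|rewrite -(hplus_halfspace_class medM hH)].
by exists y; split; [right|rewrite -(hplus_halfspace_class medM hH)].
Qed.

Lemma pullback_image x y : y = x \/ adj y x -> pullback f (f y) x.
Proof. by move=> yx; apply/pullbackP => H _ Hy; exists y. Qed.

Lemma pullback_median_decomposition : median_decomposition (pullback f).
Proof.
split.
- apply/seteqP; split=> // x _; exists (f x) => //.
  by apply: pullback_image; left.
- move=> x y xy; exists (f x).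
  by split; apply: pullback_image; [left|right].
move=> x; apply/(convexP medM) => u v w /pullbackP ux /pullbackP vx uwv.
apply/pullbackP => H hH Hw; apply: contrapT => noH.
have [Hu|nHu] := pselect (H u); first exact/noH/ux.
have [Hv|nHv] := pselect (H v); first exact/noH/vx.
exact: (halfspace_convex medM (halfspaceC medM hH) nHu nHv uwv).
Qed.

(** Apply [pullbackP] to each separating halfspace and to its complement. *)
Lemma pullback_separating_halfspaces x u v : pullback f u x -> pullback f v x ->
  exists Hs : 'I_(dist u v) -> set M,
  [/\ forall i, halfspace (Hs i), injective Hs, forall i, Hs i u /\ ~ Hs i v
    & forall i, (exists y, (y = x \/ adj y x) /\ Hs i (f y)) /\
                (exists y, (y = x \/ adj y x) /\ ~ Hs i (f y))].
Proof.
move=> /pullbackP ux /pullbackP vx.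
have [Hs [hH injH sepH]] := geodesic_halfspaces medM u v.
exists Hs; split=> // i; have [Hu Hv] := sepH i.
by split; [apply: ux|apply: (vx _ (halfspaceC medM (hH i)))].
Qed.

Variable A : nat.
Hypothesis f_lipschitz : forall x y, dist (f x) (f y) <= A * dist x y + A.

Lemma image_nbhd_dist x y : y = x \/ adj y x -> dist (f x) (f y) <= A.*2.
Proof.
move=> yx; apply: leq_trans (f_lipschitz x y) _.
rewrite -addnn leq_add2r -[leqRHS]muln1 leq_mul2l; apply/orP; right.
by case: yx => [->|yx]; rewrite ?distxx // (dist_sym connG) (dist_adj connG).
Qed.

Lemma bounded_fibres_bounded_degree : bounded_degree G -> bounded_fibres (pullback f).
Proof.
move=> [D degD]; exists (D * A.*2) => x u v ux vx.
have [Hs [hH injH sepH meetH]] := pullback_separating_halfspaces ux vx.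
have /pcard_leP[e] := degD x.
(* Orient each halfspace towards [f x]; it then misses [f y] for some neighbour [y] of [x]. *)
pose Hx i := side (Hs i) `[< Hs i (f x) >].
have Hxx i : Hx i (f x) by rewrite /Hx /side; case: ifPn => /asboolP.
(* All the [Hs i] contain [u], so no two are complementary and reorienting identifies none of
   them. *)
have injHx : injective Hx.
  move=> i j; have [Hiu _] := sepH i; have [Hju _] := sepH j.
  rewrite /Hx /side; case: ifP => _; case: ifP => _ E; apply: injH => //.
  - by move: Hiu; rewrite E => /(_ Hju).
  - by move: Hju; rewrite -E => /(_ Hiu).
  - by rewrite -[LHS]setCK E setCK.
have far i : exists y, adj x y /\ ~ Hx i (f y).
  have [[y [yx Hy]] [z [zx Hz]]] := meetH i.
  rewrite /Hx /side; case: ifPn => /asboolP Hix.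
    exists z; split=> //; case: zx => [zx|]; last by rewrite adj_sym.
    by rewrite zx in Hz.
  exists y; split; last by [].
  by case: yx => [yx|]; [rewrite yx in Hy|rewrite adj_sym].
have [y yP] := choice far.
(* Classify the halfspaces by neighbour: those of one neighbour [y] all separate [f x] from [f y],
   so there are at most [A.*2]. *)
rewrite -(card_ord (dist u v)); apply: (@card_le_levels _ (fun i => e (y i))).
  by move=> i; have [xy _] := yP i; apply: (funS (s := e)).
move=> c.
case: (pickP {: {i | e (y i) == c}}) => [i0 _|no]; last by rewrite eq_card0.
have [xy _] := yP (val i0).
apply: leq_trans (image_nbhd_dist (y := y (val i0)) (x := x) _); last first.
  by right; rewrite adj_sym.
apply: (separating_halfspaces_le medM (Hs := fun i => Hx (val i))).
- by move=> i; apply: halfspace_side.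
- by move=> i j /injHx/val_inj.
move=> i; split=> //; have [xyi Hyi] := yP (val i).
suff <- : y (val i) = y (val i0) by [].
apply: (inj (f := e)); rewrite ?inE //.
exact: etrans (eqP (valP i)) (esym (eqP (valP i0))).
Qed.

Lemma bounded_fibres_crossing_bounded :
  crossing_bounded M -> bounded_fibres (pullback f).
Proof.
move=> [N cbN]; exists (A.*2.*2.+1 * N) => x u v ux vx.
have [Hs [hH injH sepH meetH]] := pullback_separating_halfspaces ux vx.
pose S := [set f y | y in [set y | y = x \/ adj y x]].
have diamS : diam_le S A.*2.*2.
  move=> _ _ [y yx <-] [z zx <-]; have := dist_triangle connM (f x) (f y) (f z).
  rewrite (dist_sym connM (f y) (f x)); have := image_nbhd_dist yx.
  have := image_nbhd_dist zx; lia.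
(* The level is the exact depth relative to [S]; it is positive, as [depth_ge_proper] demands, and
   at most [A.*2.*2]. *)
have level i : exists k, [/\ 0 < k, k <= A.*2.*2, depth_ge S (Hs i) k
    & forall j, depth_ge S (Hs i) j -> j <= k].
  have [[y [yx Hy]] [z [zx Hz]]] := meetH i.
  have Sy : S (f y) by exists y.
  have Sz : S (f z) by exists z.
  have bound k : depth_ge S (Hs i) k -> k <= A.*2.*2.
    exact: (depth_ge_bounded diamS Sz Hz).
  have [|k kH kmax] := max_exists _ bound; first by exists (f y).
  exists k; split=> //; last exact: bound.
  exact/kmax/(depth_ge1 medM Sy Hy).
have [l lP] := choice level.
rewrite -(card_ord (dist u v)); apply: (@card_le_levels _ l) => [i|c].
  by have [] := lP i.
(* Distinct halfspaces of equal depth are not nested, by [depth_ge_proper]; all contain [u] and miss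
   [v], so they cross. *)
have nested i j : i != j -> l i = l j -> Hs i `&` ~` Hs j !=set0.
  move=> ij lij; apply: contrapT => empty.
  have sub : Hs i `<=` Hs j.
    by move=> w Hi; apply: contrapT => Hj; apply: empty; exists w.
  have neq : Hs i <> Hs j by move=> /injH e; rewrite e eqxx in ij.
  have [li _ Hli _] := lP i; have [_ _ _ maxj] := lP j.
  have := maxj _ (depth_ge_proper medM (hH i) (hH j) sub neq li Hli).
  by rewrite lij ltnn.
apply: (crossing_halfspaces_le medM cbN (Hs := fun i => Hs (val i))) => //.
  by move=> i j /injH/val_inj.
move=> i j ij; have lij : l (val i) = l (val j).
  exact: etrans (eqP (valP i)) (esym (eqP (valP j))).
have [[ui vi] [uj vj]] := (sepH (val i), sepH (val j)); split.
- by exists u.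
- exact: nested.
- by rewrite setIC; apply: nested; rewrite // eq_sym.
- by exists v.
Qed.

Lemma pullback_properly_supported : bounded_fibres (pullback f) ->
  (forall n, exists B, forall x y, dist (f x) (f y) <= n -> dist x y <= B) ->
  properly_supported (pullback f).
Proof.
(* The route is [f x], [p], [v], [q], [f y]; its outer parts stay in the fibres over [x] and [y]. *)
move=> [D diamD] lower r; have [B BP] := lower (D + r + r + D).
exists B => v x y [p px vp] [q qy vq]; apply: BP.
have := diamD x _ _ (pullback_image (or_introl erefl)) px.
have := diamD y _ _ qy (pullback_image (or_introl erefl)).
have := dist_triangle connM p (f x) (f y); have := dist_triangle connM q p (f y).
have := dist_triangle connM v p q; rewrite (dist_sym connM p v); lia.
Qed.

Lemma pullback_quasi_densely_supported C :
  (forall v, exists x, dist v (f x) <= C) -> quasi_densely_supported (pullback f).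
Proof.
move=> dense; exists C => v; have [x vx] := dense v; exists (f x).
rewrite (dist_sym connM); split=> //; exists x.
by apply: pullback_image; left.
Qed.

End Pullback.

Lemma pullback_canonical (Gamma : groupType) (G M : ggraph Gamma) (f : G -> M) :
  median_graph M -> equivariant f -> canonical_decomposition (pullback f).
Proof.
move=> medM eqf.
have sub (h : Gamma) v : act h @` pullback f v `<=` pullback f (act h v).
  move=> _ [x /(pullbackP medM) vx <-]; apply/(pullbackP medM) => H hH Hv.
  have [||y [yx Hy]] := vx (act h @^-1` H) => //.
    exact: halfspace_act (median_connected medM) _ _ hH.
  exists (act h y); rewrite -eqf; split=> //.
  by case: yx => [->|yx]; [left|right; rewrite act_adj].
move=> g v; apply/seteqP; split; first exact: sub.
move=> x xv; exists (act (g^-1)%g x); last exact: actVK.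
by rewrite -[v](actK g); apply: sub; exists x.
Qed.

Theorem theorem8p8 (R : realType) (Gamma : groupType) (G M : ggraph Gamma)
    (G_connected : connected_graph G) (M_median : median_graph M) :
  (forall beta : M -> set G,
     median_decomposition beta -> canonical_decomposition beta ->
     (proper_decomposition beta ->
        exists f : G -> gsubdivision M,
          equivariant f /\ coarse_embedding R f) /\
     (crossing_bounded M -> geometric_decomposition beta ->
        exists f : G -> gsubdivision M,
          equivariant f /\ quasi_isometry R f)) /\
  (bounded_degree G \/ crossing_bounded M ->
   forall f : G -> M, equivariant f ->
     (coarse_embedding R f ->
        [/\ median_decomposition (pullback f),
            canonical_decomposition (pullback f)
          & proper_decomposition (pullback f)]) /\
     (quasi_isometry R f ->
        [/\ median_decomposition (pullback f),
            canonical_decomposition (pullback f)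
          & geometric_decomposition (pullback f)])).
Proof.
split=> [beta decM canM|bounded f eqf].
  split=> [[[D diamD] supp]|cb [[[D diamD] supp] [r dense]]].
    exists (fibre_center M_median decM diamD); split.
      exact: fibre_center_equivariant.
    exact: fibre_center_coarse_embedding.
  have [N dimN] := crossing_bounded_cube_dim M_median cb.
  exists (fibre_center M_median decM diamD); split.
    exact: fibre_center_equivariant.
  exact: fibre_center_quasi_isometry dimN.
have decM := pullback_median_decomposition M_median f.
have canM := pullback_canonical M_median eqf.
have proper : coarse_embedding R f -> proper_decomposition (pullback f).
  move=> ce; have [A upper] := coarse_embedding_upper ce.
  have bf : bounded_fibres (pullback f).
    case: bounded; first exact: bounded_fibres_bounded_degree upper.
    exact: bounded_fibres_crossing_bounded upper.
  split=> //; apply: pullback_properly_supported => //.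
  exact: coarse_embedding_lower ce.
split=> [ce|qi]; first by split=> //; apply: proper.
split=> //; have [ce _ _] := qi; split; first exact: proper.
have [C dense] := quasi_isometry_dense qi.
exact: pullback_quasi_densely_supported dense.
Qed.
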